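(* Let $E$ be an elliptic curve over $\mathbb{C}$, let $\pi\colon E\to E/\{\pm1\}\cong\mathbb{P}^1$ be the quotient map, and let $\ell$ and $m$ be relatively prime integers greater than $2$. Let $K$, $L$ and $M$ each be the function field of $\mathbb{P}^1=E/\{\pm1\}$, where the inclusions $K\hookrightarrow L$ and $K\hookrightarrow M$ are the field embeddings corresponding to the Lattès maps $\langle\ell\rangle\colon\mathbb{P}^1\to\mathbb{P}^1$ and $\langle m\rangle\colon\mathbb{P}^1\to\mathbb{P}^1$ respectively. Then $L/K$ and $M/K$ are each ramified over the same four points, and $L\otimes_K M$ is isomorphic to the function field of $\mathbb{P}^1=E/\{\pm 1\}$, regarded as an extension of $K$ via the Lattès map $\langle \ell m\rangle$.
   Context: For a positive integer $n$, multiplication by $n$ on $E$, denoted $[n]\colon E\to E$, commutes with $z\mapsto -z$ and hence induces the Lattès map $\langle n\rangle\colon\mathbb{P}^1\to\mathbb{P}^1$ on $\mathbb{P}^1=E/\{\pm1\}$, characterized by $\pi\circ[n]=\langle n\rangle\circ\pi$; it has degree $n^2$. An extension of the function field $K$ of $\mathbb{P}^1$ is ramified over a point $x\in\mathbb{P}^1(\mathbb{C})$ if some valuation of the extension lying over the valuation of $x$ has ramification index greater than $1$. *)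

(* Defs.v *)
From HB Require Import structures.
From mathcomp Require Import all_boot all_order all_algebra.
From mathcomp Require Export complex.
From mathcomp Require Import boolp.
From mathcomp Require Export reals.
From mathcomp Require Import ring.

Set Implicit Arguments.
Unset Strict Implicit.
Unset Printing Implicit Defensive.

Import Order.TTheory GRing.Theory Num.Theory.
Local Open Scope ring_scope.

(* The set of points of the projective line: [Some a] is the point [a : 1],
   [None] is the point at infinity [1 : 0]. *)
Definition P1 (C : Type) := option C.

Notation ratfun C := {fraction {poly C}}.

Section RationalFunctions.
Variable C : fieldType.
Implicit Types (f : ratfun C) (x : P1 C).

(* The representative chosen by [repr] need not be in lowest terms, hence the
   division by the gcd. *)
Definition numer f : {poly C} :=
  let r := repr f in \n_r %/ gcdp \n_r \d_r.
Definition denom f : {poly C} :=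
  let r := repr f in \d_r %/ gcdp \n_r \d_r.

(* The morphism P^1 -> P^1 given by a rational function. *)
Definition evalP1 f x : P1 C :=
  match x with
  | Some a => if root (denom f) a then None
              else Some ((numer f).[a] / (denom f).[a])
  | None => if (size (denom f) < size (numer f))%N then None
            else Some ((numer f)`_(size (denom f)).-1 / lead_coef (denom f))
  end.

(* The normalized valuation of the point x of P^1; only its values at nonzero
   rational functions are meaningful. *)
Definition ordP1 x f : int :=
  match x with
  | Some a => (mup a (numer f))%:Z - (mup a (denom f))%:Z
  | None => (size (denom f))%:Z - (size (numer f))%:Z
  end.

(* i is the field embedding f |-> f o h attached to h : P^1 -> P^1. *)
Definition is_pullback (h : P1 C -> P1 C) (i : ratfun C -> ratfun C) : Prop :=
  forall f x, evalP1 (i f) x = evalP1 f (h x).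

End RationalFunctions.

(* Normalized discrete valuations; the (infinite) value at 0 is not recorded,
   so that w 0 is irrelevant. *)
Definition discrete_valuation (F : fieldType) (w : F -> int) : Prop :=
  [/\ forall x y, x != 0 -> y != 0 -> w (x * y) = w x + w y,
      forall x y, x != 0 -> y != 0 -> x + y != 0 ->
        Num.min (w x) (w y) <= w (x + y)
    & forall n : int, exists2 x, x != 0 & w x = n].

(* As v and w are normalized, e is the index of the value group of v in that of
   w, that is, the ramification index. *)
Definition lies_over (K L : fieldType) (i : K -> L)
    (v : K -> int) (w : L -> int) (e : nat) : Prop :=
  [/\ discrete_valuation w, (0 < e)%N
    & forall k, k != 0 -> w (i k) = e%:Z * v k].

Definition ramified_over (C L : fieldType) (i : ratfun C -> L) (x : P1 C) :
    Prop :=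
  exists w : L -> int, exists e : nat,
    lies_over i (ordP1 x) w e /\ (1 < e)%N.

Section Tensor.
Variables (K A B : comNzRingType).
Variables (i : {rmorphism K -> A}) (j : {rmorphism K -> B}).

(* The sequence [:: (a1, b1); (a2, b2); ...] stands for the formal sum
   a1 (x) b1 + a2 (x) b2 + ..., and tensor_eq is the congruence generated by the
   defining relations of the tensor product of A and B over K. *)
Implicit Types s t u : seq (A * B).

Inductive tensor_eq : seq (A * B) -> seq (A * B) -> Prop :=
| teq_refl s : tensor_eq s s
| teq_sym s t : tensor_eq s t -> tensor_eq t s
| teq_trans s t u : tensor_eq s t -> tensor_eq t u -> tensor_eq s u
| teq_cat s s' t t' :
    tensor_eq s s' -> tensor_eq t t' -> tensor_eq (s ++ t) (s' ++ t')
| teq_catC s t : tensor_eq (s ++ t) (t ++ s)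
| teq_0 b : tensor_eq [:: (0, b)] [::]
| teq_Dl a a' b : tensor_eq [:: (a + a', b)] [:: (a, b); (a', b)]
| teq_Dr a b b' : tensor_eq [:: (a, b + b')] [:: (a, b); (a, b')]
| teq_bal a k b : tensor_eq [:: (a * i k, b)] [:: (a, j k * b)].

Definition tensor_eqb s t : bool := `[< tensor_eq s t >].

Lemma tensor_eqb_refl : reflexive tensor_eqb.
Proof. by move=> s; apply/asboolP; exact: teq_refl. Qed.

Lemma tensor_eqb_sym : symmetric tensor_eqb.
Proof. by move=> s t; apply/asboolP/asboolP; exact: teq_sym. Qed.

Lemma tensor_eqb_trans : transitive tensor_eqb.
Proof. by move=> t s u /asboolP st /asboolP tu; apply/asboolP; exact: teq_trans st tu. Qed.

Canonical tensor_equiv :=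
  EquivRel tensor_eqb tensor_eqb_refl tensor_eqb_sym tensor_eqb_trans.

Definition tensor := {eq_quot tensor_eqb}%qT.
HB.instance Definition _ := Choice.on tensor.
HB.instance Definition _ := EqQuotient.on tensor.

Definition tcls s : tensor := (\pi_tensor s)%qT.

Lemma tclsP s t : tcls s = tcls t <-> tensor_eq s t.
Proof.
by split=> [/eqP|st]; [rewrite eqmodE => /asboolP|apply/eqP; rewrite eqmodE; apply/asboolP].
Qed.

Lemma repr_tcls s : tensor_eq (repr (tcls s)) s.
Proof. by apply/tclsP; rewrite /tcls reprK. Qed.

Lemma tcls_repr (x : tensor) : tcls (repr x) = x.
Proof. exact: reprK. Qed.

Definition tneg s := [seq (- p.1, p.2) | p <- s].
Definition tmul s t : seq (A * B) :=
  [seq (p.1 * q.1, p.2 * q.2) | p <- s, q <- t].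

Lemma teq_perm s t : perm_eq s t -> tensor_eq s t.
Proof.
elim: s t => [|p s IH] t; first by rewrite perm_sym => /perm_nilP ->; exact: teq_refl.
move=> st; have pt : p \in t by rewrite -(perm_mem st) mem_head.
case/splitPr: pt st => t1 t2 st.
have {}st : perm_eq s (t1 ++ t2).
  by rewrite -(perm_cons p); apply: perm_trans st _; rewrite perm_catC /= perm_cons perm_catC.
apply: teq_trans (teq_cat (teq_refl [:: p]) (IH _ st)) _.
rewrite catA -[p :: t2]cat1s catA; apply: teq_cat (teq_refl _); exact: teq_catC.
Qed.

Lemma teq_neg s t : tensor_eq s t -> tensor_eq (tneg s) (tneg t).
Proof.
elim=> {s t} [s|s t _ IH|s t u _ IH1 _ IH2|s s' t t' _ IH1 _ IH2|s t|b|a a' b|a b b'|a k b];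
  rewrite /tneg ?map_cat /=.
- exact: teq_refl.
- exact: teq_sym.
- exact: teq_trans IH1 IH2.
- exact: teq_cat.
- exact: teq_catC.
- rewrite oppr0; exact: teq_0.
- rewrite opprD; exact: teq_Dl.
- exact: teq_Dr.
- rewrite -mulNr; exact: teq_bal.
Qed.

Lemma teq_negl s : tensor_eq (tneg s ++ s) [::].
Proof.
elim: s => [|[a b] s IH]; first exact: teq_refl.
apply: (@teq_trans _ ([:: (- a, b); (a, b)] ++ (tneg s ++ s))).
  apply: teq_perm; rewrite /= perm_cons -cat1s catA.
  by rewrite -[X in perm_eq _ X](cat1s (a, b)) catA perm_cat2r perm_catC.
rewrite -[X in tensor_eq _ X]cats0; apply: teq_cat IH.
apply: teq_trans (teq_0 b); rewrite -(addNr a); apply: teq_sym; exact: teq_Dl.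
Qed.

Lemma tmul_catl s s' t : tmul (s ++ s') t = tmul s t ++ tmul s' t.
Proof. by rewrite /tmul allpairs_cat. Qed.

Lemma tmulC s t : tensor_eq (tmul s t) (tmul t s).
Proof.
apply: teq_perm; elim: s t => [|p s IH] t.
  by rewrite /tmul; elim: t.
rewrite -cat1s tmul_catl -cat1s.
apply: (@perm_trans _ (tmul t [:: p] ++ tmul t s)).
  apply: perm_cat (IH t); rewrite /tmul /= cats0; clear IH.
  by elim: t => //= q t IHt; rewrite [p.1 * _]mulrC [p.2 * _]mulrC perm_cons.
by rewrite perm_sym; apply/permPl; exact: perm_allpairs_catr.
Qed.

Lemma tmulA s t u : tmul s (tmul t u) = tmul (tmul s t) u.
Proof.
elim: s => // p s IH; rewrite -cat1s !tmul_catl IH; congr (_ ++ _).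
rewrite /tmul /= !cats0; clear IH; elim: t => //= q t IHt.
rewrite map_cat IHt; congr (_ ++ _).
by rewrite -map_comp; apply: eq_map => r /=; rewrite !mulrA.
Qed.

Lemma tmul1 s : tmul [:: (1, 1)] s = s.
Proof.
by rewrite /tmul /= cats0 -[RHS]map_id; apply: eq_map => -[a b] /=; rewrite !mul1r.
Qed.

Lemma teq_mulr s t t' : tensor_eq t t' -> tensor_eq (tmul s t) (tmul s t').
Proof.
move=> tt'.
elim: s => [|[c d] s IHs]; first exact: teq_refl.
rewrite -cat1s !tmul_catl; apply: teq_cat IHs; rewrite /tmul /= !cats0.
elim: tt' => {s t t'} [s|s t _ IH|s t u _ IH1 _ IH2|s s' t t' _ IH1 _ IH2|s t|b|a a' b|a b b'|a k b];
  rewrite ?map_cat /=.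
- exact: teq_refl.
- exact: teq_sym.
- exact: teq_trans IH1 IH2.
- exact: teq_cat.
- exact: teq_catC.
- rewrite mulr0; exact: teq_0.
- rewrite mulrDr; exact: teq_Dl.
- rewrite mulrDr; exact: teq_Dr.
- rewrite mulrA [d * (_ * _)]mulrCA; exact: teq_bal.
Qed.

Lemma teq_mul s s' t t' :
  tensor_eq s s' -> tensor_eq t t' -> tensor_eq (tmul s t) (tmul s' t').
Proof.
move=> ss' tt'; apply: teq_trans (teq_mulr s tt') _.
apply: teq_trans (tmulC _ _) _; apply: teq_trans (teq_mulr t' ss') _.
exact: tmulC.
Qed.

Definition tensor_zero : tensor := tcls [::].
Definition tensor_one : tensor := tcls [:: (1, 1)].
Definition tensor_add (x y : tensor) : tensor := tcls (repr x ++ repr y).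
Definition tensor_opp (x : tensor) : tensor := tcls (tneg (repr x)).
Definition tensor_mul (x y : tensor) : tensor := tcls (tmul (repr x) (repr y)).

Lemma tensor_addE s t : tensor_add (tcls s) (tcls t) = tcls (s ++ t).
Proof. by apply/tclsP; apply: teq_cat; exact: repr_tcls. Qed.

Lemma tensor_oppE s : tensor_opp (tcls s) = tcls (tneg s).
Proof. by apply/tclsP; apply: teq_neg; exact: repr_tcls. Qed.

Lemma tensor_mulE s t : tensor_mul (tcls s) (tcls t) = tcls (tmul s t).
Proof. by apply/tclsP; apply: teq_mul; exact: repr_tcls. Qed.

Lemma tensor_addA : associative tensor_add.
Proof.
move=> x y z; rewrite -(tcls_repr x) -(tcls_repr y) -(tcls_repr z).
by rewrite !tensor_addE catA.
Qed.

Lemma tensor_addC : commutative tensor_add.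
Proof.
move=> x y; rewrite -(tcls_repr x) -(tcls_repr y) !tensor_addE.
by apply/tclsP; exact: teq_catC.
Qed.

Lemma tensor_add0 : left_id tensor_zero tensor_add.
Proof. by move=> x; rewrite -(tcls_repr x) tensor_addE. Qed.

Lemma tensor_addN : left_inverse tensor_zero tensor_opp tensor_add.
Proof.
move=> x; rewrite -(tcls_repr x) tensor_oppE tensor_addE.
by apply/tclsP; exact: teq_negl.
Qed.

HB.instance Definition _ :=
  GRing.isZmodule.Build tensor tensor_addA tensor_addC tensor_add0 tensor_addN.

Lemma tensor_mulA : associative tensor_mul.
Proof.
move=> x y z; rewrite -(tcls_repr x) -(tcls_repr y) -(tcls_repr z).
by rewrite !tensor_mulE tmulA.
Qed.

Lemma tensor_mulC : commutative tensor_mul.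
Proof.
move=> x y; rewrite -(tcls_repr x) -(tcls_repr y) !tensor_mulE.
by apply/tclsP; exact: tmulC.
Qed.

Lemma tensor_mul1 : left_id tensor_one tensor_mul.
Proof. by move=> x; rewrite -(tcls_repr x) tensor_mulE tmul1. Qed.

Lemma tensor_mulDl : left_distributive tensor_mul tensor_add.
Proof.
move=> x y z; rewrite -(tcls_repr x) -(tcls_repr y) -(tcls_repr z).
by rewrite !(tensor_addE, tensor_mulE) tmul_catl.
Qed.

(* Not a nonzero ring in general, since i and j need not be injective. *)
HB.instance Definition _ :=
  GRing.Zmodule_isComPzRing.Build tensor
    tensor_mulA tensor_mulC tensor_mul1 tensor_mulDl.

Definition pure_tensor (a : A) (b : B) : tensor := tcls [:: (a, b)].

Definition tensor_in (k : K) : tensor := pure_tensor (i k) 1.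

Lemma tensor_inE (k : K) : tensor_in k = pure_tensor 1 (j k).
Proof.
by apply/tclsP; rewrite -[i k]mul1r -[j k]mulr1; exact: teq_bal.
Qed.

End Tensor.

Section EllipticCurves.
Variable C : numClosedFieldType.

(* The smooth projective curve y^2 = x^3 + a x + b. *)
Record elliptic_curve := EllipticCurve {
  ec_a : C;
  ec_b : C;
  ec_smooth : 4%:R * ec_a ^+ 3 + 27%:R * ec_b ^+ 2 != 0
}.

Variable E : elliptic_curve.
Local Notation a := (ec_a E).
Local Notation b := (ec_b E).

(* [None] is the point at infinity, the origin of the group law. *)
Definition on_curve (p : option (C * C)) : bool :=
  if p is Some (x, y) then y ^+ 2 == x ^+ 3 + a * x + b else true.

Record point := Point { pt : option (C * C); pt_on_curve : on_curve pt }.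
HB.instance Definition _ := [isSub for pt].
HB.instance Definition _ := [Choice of point by <:].

Definition chord_tangent (x1 y1 x2 s : C) : C * C :=
  let x3 := s ^+ 2 - x1 - x2 in (x3, s * (x1 - x3) - y1).

Definition raw_add (p q : option (C * C)) : option (C * C) :=
  match p, q with
  | None, _ => q
  | _, None => p
  | Some (x1, y1), Some (x2, y2) =>
      if x1 != x2 then Some (chord_tangent x1 y1 x2 ((y2 - y1) / (x2 - x1)))
      else if y1 == - y2 then None
      else Some (chord_tangent x1 y1 x2 ((3%:R * x1 ^+ 2 + a) / (2%:R * y1)))
  end.

Definition raw_opp (p : option (C * C)) : option (C * C) :=
  if p is Some (x, y) then Some (x, - y) else None.

Lemma same_x_on_curve x y1 y2 :
  on_curve (Some (x, y1)) -> on_curve (Some (x, y2)) -> y1 = y2 \/ y1 = - y2.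
Proof.
move=> /eqP e1 /eqP e2.
have : (y1 == y2) || (y1 == - y2) by rewrite -eqf_sqr e1 e2.
by case/orP=> /eqP ->; [left|right].
Qed.

Lemma raw_opp_on_curve p : on_curve p -> on_curve (raw_opp p).
Proof. by case: p => // -[x y] /=; rewrite sqrrN. Qed.

Lemma raw_add_on_curve p q :
  on_curve p -> on_curve q -> on_curve (raw_add p q).
Proof.
case: p => [[x1 y1]|//]; case: q => [[x2 y2]|//] cp cq.
rewrite /raw_add; case: (eqVneq x1 x2) => [x12|x12] /=; last first.
  have d0 : x2 - x1 != 0 by rewrite subr_eq0 eq_sym.
  move/eqP: cp => cp; move/eqP: cq => cq.
  have eb : b = y1 ^+ 2 - x1 ^+ 3 - a * x1 by rewrite cp; ring.
  have ea : a = (y2 ^+ 2 - y1 ^+ 2 - (x2 ^+ 3 - x1 ^+ 3)) / (x2 - x1).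
    by rewrite cq cp; field.
  by apply/eqP; rewrite eb ea; field.
subst x2; case: eqP => // y12 /=.
have ey : y1 = y2 by case: (same_x_on_curve cp cq).
subst y2.
have y0 : y1 != 0 by apply/eqP => y0; apply: y12; rewrite y0 oppr0.
move/eqP: cp => cp.
have eb : b = y1 ^+ 2 - x1 ^+ 3 - a * x1 by rewrite cp; ring.
by apply/eqP; rewrite eb; field; rewrite y0 ?pnatr_eq0.
Qed.

Definition ec_zero : point := @Point None isT.
Definition ec_opp (P : point) : point :=
  Point (raw_opp_on_curve (pt_on_curve P)).
Definition ec_add (P Q : point) : point :=
  Point (raw_add_on_curve (pt_on_curve P) (pt_on_curve Q)).

Definition ec_mul (n : nat) (P : point) : point := iter n (ec_add P) ec_zero.

Lemma ec_oppK : involutive ec_opp.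
Proof. by move=> P; apply: val_inj; case: P => -[[x y]|] //= _; rewrite opprK. Qed.

Lemma ec_oppD P Q : ec_add (ec_opp P) (ec_opp Q) = ec_opp (ec_add P Q).
Proof.
apply: val_inj; case: P Q => -[[x1 y1]|] p; case=> -[[x2 y2]|] q //=.
have tsq (s x3 : C) : ((- s) ^+ 2 - x1 - x2 = s ^+ 2 - x1 - x2) *
  (- s * x3 - - y1 = - (s * x3 - y1)) by split; ring.
rewrite /chord_tangent; case: eqVneq => [x12|x12] /=.
  rewrite eqr_opp; case: (y1 == - y2) => //=.
  by rewrite [2%:R * - y1]mulrN invrN mulrN !tsq.
have -> : (- y2 - - y1) / (x2 - x1) = - ((y2 - y1) / (x2 - x1)).
  by rewrite -opprD mulNr.
by rewrite !tsq.
Qed.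

Lemma ec_mulN n P : ec_mul n (ec_opp P) = ec_opp (ec_mul n P).
Proof.
elim: n => [|n IH]; first exact: val_inj.
by rewrite /ec_mul /= -/(ec_mul n _) -/(ec_mul n P) IH ec_oppD.
Qed.

(* The quotient map E -> E/{+-1}, which the x-coordinate identifies with P^1:
   see ec_pi_eqP for the fibres and ec_liftK for surjectivity. *)
Definition ec_pi (P : point) : P1 C := omap fst (pt P).

Lemma ec_pi_eqP P Q : ec_pi P = ec_pi Q <-> P = Q \/ P = ec_opp Q.
Proof.
split; last first.
  by case=> ->//; case: Q => -[[x y]|].
case: P Q => -[[x1 y1]|] p; case=> -[[x2 y2]|] q //=; last first.
  by left; apply: val_inj.
case=> x12; subst x2; case: (same_x_on_curve p q) => y12; [left|right];
  by apply: val_inj; rewrite /= y12.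
Qed.

Definition ec_lift_raw (x : P1 C) : option (C * C) :=
  if x is Some c then Some (c, sqrtC (c ^+ 3 + a * c + b)) else None.

Lemma ec_lift_on_curve x : on_curve (ec_lift_raw x).
Proof. by case: x => //= c; rewrite sqrtCK. Qed.

Definition ec_lift (x : P1 C) : point := Point (ec_lift_on_curve x).

Lemma ec_liftK : cancel ec_lift ec_pi.
Proof. by case. Qed.

(* Any preimage under ec_pi may be used instead of ec_lift x, see ec_pi_mul. *)
Definition lattes (n : nat) (x : P1 C) : P1 C := ec_pi (ec_mul n (ec_lift x)).

Lemma ec_pi_mul n P : ec_pi (ec_mul n P) = lattes n (ec_pi P).
Proof.
rewrite /lattes; have /ec_pi_eqP[->//|->] : ec_pi (ec_lift (ec_pi P)) = ec_pi P.
  exact: ec_liftK.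
by rewrite ec_mulN; apply/ec_pi_eqP; right; rewrite ec_oppK.
Qed.

Lemma lattes_unique n (h : P1 C -> P1 C) :
  (forall P, ec_pi (ec_mul n P) = h (ec_pi P)) -> h =1 lattes n.
Proof. by move=> hP x; rewrite -(ec_liftK x) -hP ec_pi_mul. Qed.

End EllipticCurves.

(* Main.v *)
(** Let [X] be the coordinate on P^1. Computing with the multiples of the generic
point [(X, y)] of E shows that the Lattes map of degree n is given by a rational
function phi = A / B with deg A = n^2, deg B = n^2 - 1, and that invariance of the
differential dx / y reads phi'^2 f(X) = n^2 f(phi), where f = X^3 + a X + b. No
associativity of the group law is needed.

This equation says that phi is unramified over the points outside
{oo, e1, e2, e3}, the e_i being the roots of f; and if phi were unramified at all
the points above one of these four, then A - e_i B or B would divide f, which is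
impossible as n^2 > 4. Solutions of the equation with a pole at infinity are
unique, which gives the commutation <l> o <m> = <m> o <l> = <lm>.

Finally 1, X, ..., X^(n^2 - 1) is a basis of C(X) over C(phi). As l^2 and m^2 are
coprime, the compositum of C(phi_l) and C(phi_m) in C(X) is everything, its degree
over C(phi_lm) being divisible by l^2 and m^2, and both surjectivity and injectivity
of the map from the tensor product follow by counting dimensions. *)

Require Import Defs.
From HB Require Import structures.
From mathcomp Require Import all_boot all_order all_algebra all_field.
From mathcomp Require Import ring boolp zify.

Set Implicit Arguments.
Unset Strict Implicit.
Unset Printing Implicit Defensive.

Import Order.TTheory GRing.Theory Num.Theory.
Local Open Scope ring_scope.

Local Notation "p %:F" := (@FracField.tofrac _ p).

(** * Rational functions *)

(** The multiple nP is an iterated [ec_add], so without associativity nothing identifies [l] o [m]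
    with [lm]. The differential equation takes the place of the group law: by the chain rule phi_m o
    phi_l satisfies it for n = lm. The same differential keeps the induction on multiples of the
    generic point P going: the chord formula needs x(nP) to differ from x(P) = X, and u' = n v
    excludes u = X for n > 1. Degrees cannot be read off the iterated chord formulas, whose
    fractions are visibly not reduced. They come from the sum and the product of x((n + 1)P) and
    x((n - 1)P), both rational in X and x(nP); the only relation between multiples behind this is (Q
    + P) - P = Q. The leading coefficient n^2 of B is carried along because it shows that A - X B
    keeps degree n^2. That no other point is ramified concerns arbitrary valuations, so these are
    first shown to come from points of P^1; they are trivial on constants because the pullback fixes
    constants. *)

Section Fractions.
Variable C : fieldType.
Local Notation K := (ratfun C).
Implicit Types (p q : {poly C}) (g h : K) (a c : C).

Definition cst (c : C) : K := (c%:P)%:F.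
HB.instance Definition _ := GRing.RMorphism.copy cst
  ((@FracField.tofrac {poly C}) \o (@polyC C)).

Lemma fracE (g : K) : g = (\n_(repr g))%:F / (\d_(repr g))%:F.
Proof.
elim/quotW: g => x; set y := repr _.
have /eqP := FracField.equivf_l x; rewrite -/y => /eqP e.
have dy : \d_y != 0 by exact: denom_ratioP.
rewrite -[LHS](reprK) -/y.
apply: (canRL (mulfK _)); first by rewrite tofrac_eq0.
rewrite /GRing.mul /= /FracField.tofrac; unlock.
rewrite -[LHS]FracField.pi_mul.
apply/eqmodP; rewrite /= FracField.equivfE /FracField.mulf.
by rewrite !numden_Ratio ?mulf_neq0 ?oner_eq0 ?denom_ratioP // !mulr1 mulrC.
Qed.

Lemma gcd_repr_neq0 g : gcdp \n_(repr g) \d_(repr g) != 0.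
Proof. by rewrite gcdp_eq0 negb_and denom_ratioP orbT. Qed.

Lemma denom_neq0 g : denom g != 0.
Proof.
apply: contraTneq (denom_ratioP (repr g)) => e.
by rewrite -(divpK (dvdp_gcdr \n_(repr g) \d_(repr g))) -/(denom g) e mul0r eqxx.
Qed.

Lemma coprime_numer_denom g : coprimep (numer g) (denom g).
Proof. by rewrite /numer /denom coprimep_div_gcd // denom_ratioP orbT. Qed.

Lemma numer_denomE g : g = (numer g)%:F / (denom g)%:F.
Proof.
rewrite {1}(fracE g) -{1}(divpK (dvdp_gcdl \n_(repr g) \d_(repr g))).
rewrite -{3}(divpK (dvdp_gcdr \n_(repr g) \d_(repr g))) -/(numer g) -/(denom g).
by rewrite !rmorphM -mulf_div divff ?mulr1 // tofrac_eq0 gcd_repr_neq0.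
Qed.

Lemma frac_eq p q p' q' : q != 0 -> q' != 0 ->
  (p%:F / q%:F == p'%:F / q'%:F) = (p * q' == p' * q).
Proof.
by move=> q0 q'0; rewrite eqr_div ?tofrac_eq0 // -!rmorphM tofrac_eq.
Qed.

Lemma coprime_frac_eq p q p' q' : q != 0 -> coprimep p q -> coprimep p' q' ->
  q' != 0 -> p%:F / q%:F = p'%:F / q'%:F ->
  exists2 c, c != 0 & p' = c *: p /\ q' = c *: q.
Proof.
move=> q0 cpq cpq' q'0 /eqP; rewrite frac_eq // => /eqP e.
have qq' : q %| q'.
  by rewrite -(Gauss_dvdpr _ (q := p)) ?e ?dvdp_mull // coprimep_sym.
have q'q : q' %| q.
  by rewrite -(Gauss_dvdpr _ (q := p')) -?e ?dvdp_mull // coprimep_sym.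
have /eqpP[[c1 c2] /= /andP[c10 c20] e2] : q %= q' by rewrite /eqp qq' q'q.
have eq' : q' = (c1 / c2) *: q.
  by apply: (scalerI c20); rewrite -e2 scalerA mulrC divfK.
exists (c1 / c2); first by rewrite mulf_neq0 ?invr_eq0.
split=> //; apply: (mulIf q0); rewrite -e eq'.
by rewrite -scalerAr scalerAl.
Qed.

Lemma numer_denom_frac p q : q != 0 -> coprimep p q ->
  exists2 c, c != 0 & numer (p%:F / q%:F) = c *: p /\ denom (p%:F / q%:F) = c *: q.
Proof.
move=> q0 cpq; apply: coprime_frac_eq => //.
- exact: coprime_numer_denom.
- exact: denom_neq0.
- exact: numer_denomE.
Qed.

Lemma frac_coprimeP p q : q != 0 ->
  exists r p' q', [/\ q' != 0, coprimep p' q', p = p' * r & q = q' * r] /\ r != 0.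
Proof.
move=> q0; exists (gcdp p q), (p %/ gcdp p q), (q %/ gcdp p q).
have g0 : gcdp p q != 0 by rewrite gcdp_eq0 negb_and q0 orbT.
split=> //; split; rewrite ?divpK ?dvdp_gcdl ?dvdp_gcdr //.
- by rewrite divp_eq0 (negPf q0) (negPf g0) /= -leqNgt dvdp_leq ?dvdp_gcdr.
- by rewrite coprimep_div_gcd // q0 orbT.
Qed.

Lemma frac_common p' q' r : r != 0 -> (p' * r)%:F / (q' * r)%:F = p'%:F / q'%:F.
Proof.
by move=> r0; rewrite !rmorphM -mulf_div divff ?mulr1 // tofrac_eq0.
Qed.

Lemma evalP1_coprime p q a : q != 0 -> coprimep p q ->
  evalP1 (p%:F / q%:F) (Some a) = if root q a then None else Some (p.[a] / q.[a]).
Proof.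
move=> q0 /(numer_denom_frac q0)[c c0 [/= -> ->]].
rewrite rootZ //; case: ifP => // qa; congr Some; rewrite !hornerZ.
by rewrite -mulf_div divff ?mul1r.
Qed.

Lemma evalP1_frac p q a : q.[a] != 0 ->
  evalP1 (p%:F / q%:F) (Some a) = Some (p.[a] / q.[a]).
Proof.
move=> qa; have q0 : q != 0 by apply: contraNneq qa => ->; rewrite horner0.
have [r [p' [q' [[q'0 cpq pE qE] r0]]]] := frac_coprimeP p q0.
move: qa; rewrite pE qE frac_common // !hornerM mulf_eq0 => /norP[q'a ra].
by rewrite evalP1_coprime // rootE (negPf q'a) -mulf_div divff ?mulr1.
Qed.

Lemma evalP1_infty p q : q != 0 -> coprimep p q ->
  evalP1 (p%:F / q%:F) None =
    if (size q < size p)%N then None else Some (p`_(size q).-1 / lead_coef q).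
Proof.
move=> q0 /(numer_denom_frac q0)[c c0 [/= -> ->]].
rewrite !size_scale //; case: ifP => // _; congr Some.
by rewrite lead_coefZ coefZ -mulf_div divff ?mul1r.
Qed.

Lemma evalP1_cst c x : evalP1 (cst c) x = Some c.
Proof.
have -> : cst c = (c%:P)%:F / (1%:F) by rewrite rmorph1 divr1.
case: x => [a|]; first by rewrite evalP1_frac !hornerE ?oner_eq0 // divr1.
rewrite evalP1_infty ?oner_eq0 ?coprimep1 // size_poly1 ltnNge size_polyC_leq1 /=.
by rewrite coefC lead_coef1 divr1.
Qed.

Lemma evalP1_X x : evalP1 ('X%:F : K) x = x.
Proof.
have -> : 'X%:F = ('X)%:F / (1%:F) :> K by rewrite rmorph1 divr1.
case: x => [a|]; first by rewrite evalP1_frac !hornerE ?oner_eq0 // divr1.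
by rewrite evalP1_infty ?oner_eq0 ?coprimep1 // size_poly1 size_polyX.
Qed.

Lemma ordP1_frac p q a : p != 0 -> q != 0 ->
  ordP1 (Some a) (p%:F / q%:F) = (mup a p)%:Z - (mup a q)%:Z.
Proof.
move=> p0 q0 /=; set g := _ / _.
have /eqP : g = (numer g)%:F / (denom g)%:F by exact: numer_denomE.
have d0 := denom_neq0 g.
rewrite {1}/g frac_eq // => /eqP e.
have n0 : numer g != 0.
  apply: contra_eq_neq e => ->; rewrite mul0r; exact: mulf_neq0.
by have := congr1 (mup a) e; rewrite !mupM //; lia.
Qed.

Lemma ordP1_infty p q : p != 0 -> q != 0 ->
  ordP1 None (p%:F / q%:F) = (size q)%:Z - (size p)%:Z.
Proof.
move=> p0 q0 /=; set g := _ / _.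
have /eqP : g = (numer g)%:F / (denom g)%:F by exact: numer_denomE.
have d0 := denom_neq0 g.
rewrite {1}/g frac_eq // => /eqP e.
have n0 : numer g != 0.
  apply: contra_eq_neq e => ->; rewrite mul0r; exact: mulf_neq0.
have : size (p * denom g) = size (numer g * q) by rewrite e.
rewrite !size_mul //; move: p0 q0 n0 d0; rewrite -!size_poly_gt0.
by move: (size p) (size q) (size (numer g)) (size (denom g)); lia.
Qed.

Lemma fracP g : exists p q, q != 0 /\ g = p%:F / q%:F.
Proof. by exists (numer g), (denom g); rewrite denom_neq0 -numer_denomE. Qed.

Lemma fracP_neq0 g : g != 0 -> exists p q, [/\ p != 0, q != 0 & g = p%:F / q%:F].
Proof.
move=> g0; have [p [q [q0 gE]]] := fracP g; exists p, q; split=> //.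
by apply: contraNneq g0 => p0; rewrite gE p0 rmorph0 mul0r.
Qed.

Definition dfrac g : K :=
  ((numer g)^`() * denom g - numer g * (denom g)^`())%:F / (denom g ^+ 2)%:F.

(** The fraction p / q and its reduced form n / d are related by p d = n q; differentiating this
    identity once compares the two quotient rules. *)
Lemma dfrac_frac p q : q != 0 ->
  dfrac (p%:F / q%:F) = (p^`() * q - p * q^`())%:F / (q ^+ 2)%:F.
Proof.
move=> q0; rewrite /dfrac; set g := p%:F / q%:F.
have /eqP : g = (numer g)%:F / (denom g)%:F by exact: numer_denomE.
move: (denom_neq0 g); move: (numer g) (denom g) => n d d0.
rewrite {1}/g frac_eq // => /eqP e; apply/eqP; rewrite frac_eq ?expf_neq0 //.
have := congr1 deriv e; rewrite !derivM => e'; apply/eqP.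
(* Arranged so that p and its derivative enter only through p d and (p d)'; the terms p d d' q
   cancel. *)
have -> : (p^`() * q - p * q^`()) * d ^+ 2 =
  (p^`() * d + p * d^`()) * (d * q) - (p * d) * (d^`() * q + d * q^`()) by ring.
by rewrite e' e; ring.
Qed.

End Fractions.

(** * The derivation d/dX of rational functions *)

Lemma quotient_rule (L : fieldType) (g h dg dh dq : L) : h != 0 ->
  dg = dq * h + g / h * dh -> dq = (dg * h - g * dh) / h ^+ 2.
Proof. by move=> h0 ->; field. Qed.

Lemma quotient_chain (L : fieldType) (p q dp dq d : L) : q != 0 ->
  (dp * d * q - p * (dq * d)) / q ^+ 2 = (dp * q - p * dq) / q ^+ 2 * d.
Proof. by move=> q0; field. Qed.

Lemma power_rule (L : fieldType) (g d m : L) n :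
  d * g ^+ n.+1 + g * (m * g ^+ n * d) = (m + 1) * g ^+ n.+1 * d.
Proof. by rewrite exprS; ring. Qed.

Section Derivation.
Variable C : fieldType.
Local Notation K := (ratfun C).
Implicit Types (p q : {poly C}) (g h : K) (a c : C).

Lemma dfrac_poly p : dfrac (p%:F) = (p^`())%:F.
Proof.
have -> : p%:F = p%:F / (1%:F) :> K by rewrite rmorph1 divr1.
by rewrite dfrac_frac ?oner_eq0 // derivC mulr0 subr0 mulr1 expr1n rmorph1 divr1.
Qed.

Lemma dfrac_cst c : dfrac (cst c) = 0.
Proof. by rewrite dfrac_poly derivC rmorph0. Qed.

Lemma dfrac_X : dfrac ('X%:F : K) = 1.
Proof. by rewrite dfrac_poly derivX rmorph1. Qed.

Lemma dfracD g h : dfrac (g + h) = dfrac g + dfrac h.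
Proof.
have [p [q [q0 ->]]] := fracP g; have [p' [q' [q'0 ->]]] := fracP h.
rewrite addf_div ?tofrac_eq0 // -!rmorphM -rmorphD.
rewrite !dfrac_frac ?mulf_neq0 // addf_div ?tofrac_eq0 ?expf_neq0 //.
rewrite -!rmorphM -rmorphD; apply/eqP.
rewrite frac_eq ?mulf_neq0 ?expf_neq0 ?mulf_neq0 //.
by rewrite derivD !derivM; apply/eqP; ring.
Qed.

Lemma dfracM g h : dfrac (g * h) = dfrac g * h + g * dfrac h.
Proof.
have [p [q [q0 ->]]] := fracP g; have [p' [q' [q'0 ->]]] := fracP h.
rewrite mulf_div -!rmorphM.
rewrite !dfrac_frac ?mulf_neq0 // !mulf_div -!rmorphM.
rewrite addf_div ?tofrac_eq0 ?mulf_neq0 ?expf_neq0 //.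
rewrite -!rmorphM -rmorphD; apply/eqP.
rewrite frac_eq ?mulf_neq0 ?expf_neq0 ?mulf_neq0 //.
by rewrite !derivM; apply/eqP; ring.
Qed.

Lemma dfracN g : dfrac (- g) = - dfrac g.
Proof.
have := dfracD (- g) g; rewrite addNr => /eqP.
by rewrite -(rmorph0 (@cst C)) dfrac_cst eq_sym addr_eq0 => /eqP.
Qed.

Lemma dfracB g h : dfrac (g - h) = dfrac g - dfrac h.
Proof. by rewrite dfracD dfracN. Qed.

Lemma dfrac_div g h : h != 0 -> dfrac (g / h) = (dfrac g * h - g * dfrac h) / h ^+ 2.
Proof.
by move=> h0; apply: quotient_rule => //; rewrite -dfracM divfK.
Qed.

Lemma dfracXn g n : dfrac (g ^+ n.+1) = n.+1%:R * g ^+ n * dfrac g.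
Proof.
elim: n => [|n IH]; first by rewrite mulr1 mul1r.
by rewrite exprS dfracM IH -[n.+2%:R]natr1 power_rule.
Qed.

End Derivation.

(** * Rational functions as maps of P^1, and pullbacks *)

Section Infinite.
Variable C : numClosedFieldType.
Local Notation K := (ratfun C).
Implicit Types (p q : {poly C}) (g h : K) (a c : C).

Lemma poly_eq0_cofinite p r : r != 0 ->
  (forall a, r.[a] != 0 -> p.[a] = 0) -> p = 0.
Proof.
move=> r0 pr; apply/eqP; apply: contraT => p0.
have /closed_nonrootP[a] : p * r != 0 by rewrite mulf_neq0.
rewrite rootE hornerM; have [->|ra] := eqVneq r.[a] 0; first by rewrite mulr0 eqxx.
by rewrite pr // mul0r eqxx.
Qed.

(** Formulas for the multiples of a point hold only where their denominators do not vanish; this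
    suffices to determine a rational function. *)
Lemma evalP1_inj_cofinite g h r : r != 0 ->
  (forall a, r.[a] != 0 -> evalP1 g (Some a) = evalP1 h (Some a)) -> g = h.
Proof.
move=> r0 gh; rewrite (numer_denomE g) (numer_denomE h); apply/eqP.
have [d0 d0'] := (denom_neq0 g, denom_neq0 h).
rewrite frac_eq // -subr_eq0; apply/eqP.
apply: (@poly_eq0_cofinite _ (r * denom g * denom h)); first by rewrite !mulf_neq0.
move=> a; rewrite !hornerM !mulf_eq0 => /norP[/norP[ra ga] ha].
move: (gh a ra); rewrite /= !rootE (negPf ga) (negPf ha) => -[] /eqP.
by rewrite eqr_div // => /eqP e; rewrite !hornerE e subrr.
Qed.

Lemma evalP1_inj : injective (@evalP1 C).
Proof.
move=> g h gh; apply: (@evalP1_inj_cofinite _ _ 1); rewrite ?oner_eq0 // => a _.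
by rewrite gh.
Qed.

Section Pullback.
Variables (h : P1 C -> P1 C) (i : {rmorphism K -> K}).
Hypothesis iP : is_pullback h i.

Lemma pullback_cst c : i (cst c) = cst c.
Proof. by apply: evalP1_inj; apply/funext => x; rewrite iP !evalP1_cst. Qed.

Lemma evalP1_pullback_X : evalP1 (i 'X%:F) =1 h.
Proof. by move=> x; rewrite iP evalP1_X. Qed.

End Pullback.

Section ConstantFixing.
Variable i : {rmorphism K -> K}.
Hypothesis iC : forall c, i (cst c) = cst c.

Lemma rmorph_frac_poly p : i p%:F = (map_poly (@cst C) p).[i 'X%:F].
Proof.
elim/poly_ind: p => [|p c IH]; first by rewrite !rmorph0 horner0.
rewrite !rmorphD !rmorphM /= IH map_polyC map_polyX /= !hornerE.
by rewrite -[in LHS]/(cst c) iC.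
Qed.

(** Chain rule: an embedding that fixes the constants is composition with the image of X. *)
Lemma dfrac_rmorph g : dfrac (i g) = i (dfrac g) * dfrac (i 'X%:F).
Proof.
have poly p : dfrac (i p%:F) = i (p^`())%:F * dfrac (i 'X%:F).
  elim/poly_ind: p => [|p c IH].
    by rewrite deriv0 !rmorph0 mul0r -(rmorph0 (@cst C)) dfrac_cst.
  rewrite !rmorphD !rmorphM /= -/(cst c) iC dfracD dfrac_cst addr0 dfracM IH.
  by rewrite derivD derivM derivX derivC addr0 mulr1 !rmorphD !rmorphM /=; ring.
have [p [q [q0 ->]]] := fracP g.
have iq0 : i q%:F != 0 by rewrite fmorph_eq0 tofrac_eq0.
rewrite dfrac_frac // !fmorph_div dfrac_div // (poly p) (poly q) quotient_chain //.
by rewrite !(rmorphB, rmorphM, rmorphXn).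
Qed.

End ConstantFixing.
End Infinite.

(** * Chord and tangent identities *)

Section Chord.
Variable L : fieldType.
Variables X F a b u v n : L.
Hypothesis FE : F = X ^+ 3 + a * X + b.
Hypothesis two0 : 2%:R != 0 :> L.
Hypothesis F0 : F != 0.

Section ChordStep.
Hypothesis uX : u - X != 0.
Hypothesis curve : F * v ^+ 2 = u ^+ 3 + a * u + b.
Let la := (v - 1) / (u - X).
Let u3 := F * la ^+ 2 - u - X.
Let v3 := la * (X - u3) - 1.

(* With the slope [la] as a parameter, the curve equations at [(X, 1)] and
   [(u, v)] determine [a] and [v] as polynomials in [la], [u], [X], [F]: after this
   substitution the facts about the third point of the chord are identities in
   free variables. *)
Lemma chord_aE :
  a = F * la * (2%:R + la * (u - X)) - (u ^+ 2 + u * X + X ^+ 2).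
Proof.
apply: (mulIf uX); rewrite /la.
transitivity (F * v ^+ 2 - F - (u ^+ 3 - X ^+ 3)); last by field.
by rewrite curve FE; ring.
Qed.

Lemma chord_vE : v = 1 + la * (u - X).
Proof. by rewrite /la; field. Qed.

Lemma chord_curve : F * v3 ^+ 2 = u3 ^+ 3 + a * u3 + b.
Proof.
have -> : b = F - X ^+ 3 - a * X by rewrite FE; ring.
rewrite chord_aE /v3 /u3; move: la => t; ring.
Qed.

(** [dvE] is F v^2 = u^3 + a u + b differentiated with u' = n v and divided by v. Accordingly [du],
    [dla], [du3], [dv3] are the derivatives of u, [la], [u3], [v3], where F' = 3 X^2 + a. *)
Variables dv : L.
Hypothesis dvE : 2%:R * F * dv = n * (3%:R * u ^+ 2 + a) - (3%:R * X ^+ 2 + a) * v.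
Let du := n * v.
Let dla := (dv * (u - X) - (v - 1) * (du - 1)) / (u - X) ^+ 2.
Let du3 := (3%:R * X ^+ 2 + a) * la ^+ 2 + F * (2%:R * la * dla) - du - 1.
Let dv3 := dla * (X - u3) + la * (1 - du3).

Lemma chord_dE : dla = (dv - la * (n * v - 1)) / (u - X).
Proof. by rewrite /dla /du /la; field. Qed.

Lemma chord_dvE :
  dv = (n * (3%:R * u ^+ 2 + a) - (3%:R * X ^+ 2 + a) * v) / (2%:R * F).
Proof. by rewrite -dvE; field; rewrite F0 two0. Qed.

Lemma chord_du : du3 = (n + 1) * v3.
Proof.
rewrite /du3 chord_dE chord_dvE /du /v3 /u3.
rewrite chord_aE [in LHS]chord_vE.
move: la => t; set s := u - X; have -> : u = X + s by rewrite /s; ring.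
by field; rewrite uX F0 two0.
Qed.

Lemma chord_dv :
  2%:R * F * dv3 = (n + 1) * (3%:R * u3 ^+ 2 + a) - (3%:R * X ^+ 2 + a) * v3.
Proof.
rewrite /dv3 chord_du chord_dE chord_dvE /v3 /u3.
rewrite chord_aE [in LHS]chord_vE.
move: la => t; set s := u - X; have -> : u = X + s by rewrite /s; ring.
by field; rewrite uX F0 two0.
Qed.

End ChordStep.

Section Tangent.
Let la := (3%:R * X ^+ 2 + a) / (2%:R * F).
Let u3 := F * la ^+ 2 - 2%:R * X.
Let v3 := la * (X - u3) - 1.
Let dF := 3%:R * X ^+ 2 + a.
Let dla := (6%:R * X * (2%:R * F) - dF * (2%:R * dF)) / (2%:R * F) ^+ 2.
Let du3 := dF * la ^+ 2 + F * (2%:R * la * dla) - 2%:R.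
Let dv3 := dla * (X - u3) + la * (1 - du3).

Lemma tangent_curve : F * v3 ^+ 2 = u3 ^+ 3 + a * u3 + b.
Proof.
have -> : b = F - X ^+ 3 - a * X by rewrite FE; ring.
by rewrite /v3 /u3 /la; field; rewrite F0 two0.
Qed.

Lemma tangent_du : du3 = 2%:R * v3.
Proof. by rewrite /du3 /dla /v3 /u3 /la /dF; field; rewrite F0 two0. Qed.

Lemma tangent_dv : 2%:R * F * dv3 = 2%:R * (3%:R * u3 ^+ 2 + a) - dF * v3.
Proof. by rewrite /dv3 /du3 /dla /v3 /u3 /la /dF; field; rewrite F0 two0. Qed.

End Tangent.
End Chord.

(** * The degree of multiplication by n *)

(** The second slope belongs to the chord through (u, v) and (X, -1), so the two terms are the
    x-coordinates of Q + P and Q - P. Their sum, and in [chord_prod] their product, no longer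
    involve v. *)
Lemma chord_sum (L : fieldType) (X F a b u v : L) :
  F = X ^+ 3 + a * X + b -> F * v ^+ 2 = u ^+ 3 + a * u + b -> u - X != 0 ->
  (F * ((v - 1) / (u - X)) ^+ 2 - u - X) + (F * ((v + 1) / (u - X)) ^+ 2 - u - X)
  = 2%:R * ((u * X + a) * (u + X) + 2%:R * b) / (u - X) ^+ 2.
Proof.
move=> FE curve uX.
transitivity ((2%:R * (F * v ^+ 2 + F) - 2%:R * (u + X) * (u - X) ^+ 2) / (u - X) ^+ 2).
  by field.
by rewrite curve FE; congr (_ / _); ring.
Qed.

Lemma chord_prod (L : fieldType) (X F a b u v : L) :
  F = X ^+ 3 + a * X + b -> F * v ^+ 2 = u ^+ 3 + a * u + b -> u - X != 0 ->
  (F * ((v - 1) / (u - X)) ^+ 2 - u - X) * (F * ((v + 1) / (u - X)) ^+ 2 - u - X)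
  = ((u * X - a) ^+ 2 - 4%:R * b * (u + X)) / (u - X) ^+ 2.
Proof.
move=> FE curve uX.
transitivity (((F * v ^+ 2 - F) ^+ 2 - (u + X) * (u - X) ^+ 2 * 2%:R * (F * v ^+ 2 + F)
  + (u + X) ^+ 2 * (u - X) ^+ 4) / (u - X) ^+ 4); first by field.
by rewrite curve FE; field.
Qed.

Section Proportional.
Variable C : closedFieldType.
Implicit Types p q r d s : {poly C}.

Lemma dvdp_mul_primitive p q r d s :
  (forall x, p.[x] = 0 -> q.[x] = 0 -> r.[x] = 0 -> False) ->
  d %| s * p -> d %| s * q -> d %| s * r -> d %| s.
Proof.
move=> prim dp dq dr.
have : d %| gcdp (s * p) (gcdp (s * q) (s * r)) by rewrite !dvdp_gcd dp dq dr.
rewrite (eqp_dvdr _ (eqp_gcdr _ (gcdp_mul2l _ _ _))) (eqp_dvdr _ (gcdp_mul2l _ _ _)).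
suff /size_poly1P[c c0 ->] : size (gcdp p (gcdp q r)) == 1%N.
  by rewrite mulrC mul_polyC dvdpZr.
apply/negbNE/negP => /closed_rootP[x]; rewrite !root_gcd !rootE.
by move=> /andP[/eqP px /andP[/eqP qx /eqP rx]]; exact: (prim x).
Qed.

(** T0 divides S0 Ti for every i and the Ti have no common root, so T0 divides S0; by symmetry S0
    divides T0. *)
Lemma primitive_proportional (S0 S1 S2 T0 T1 T2 : {poly C}) :
  (forall x, S0.[x] = 0 -> S1.[x] = 0 -> S2.[x] = 0 -> False) ->
  (forall x, T0.[x] = 0 -> T1.[x] = 0 -> T2.[x] = 0 -> False) ->
  T0 != 0 -> T1 * S0 = S1 * T0 -> T2 * S0 = S2 * T0 ->
  exists2 c, c != 0 & T0 = c *: S0 /\ T2 = c *: S2.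
Proof.
move=> Sprim Tprim T00 e1 e2.
have TS : T0 %| S0.
  apply: (dvdp_mul_primitive Tprim); first exact: dvdp_mulIr.
    by rewrite mulrC e1 dvdp_mulIr.
  by rewrite mulrC e2 dvdp_mulIr.
have ST : S0 %| T0.
  apply: (dvdp_mul_primitive Sprim); first exact: dvdp_mulIr.
    by rewrite mulrC -e1 dvdp_mulIr.
  by rewrite mulrC -e2 dvdp_mulIr.
have /eqpP[[c1 c2] /= /andP[c10 c20] e] : T0 %= S0 by rewrite /eqp TS ST.
have eT : T0 = (c2 / c1) *: S0.
  by apply: (scalerI c10); rewrite e scalerA mulrC divfK.
exists (c2 / c1); first by rewrite mulf_neq0 ?invr_eq0.
split=> //; have S00 : S0 != 0 by apply: contraNneq T00; rewrite eT => ->; rewrite scaler0.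
by apply: (mulIf S00); rewrite e2 eT -scalerAr scalerAl.
Qed.

End Proportional.

Section DegreeStep.
Variable C : numClosedFieldType.
Variables a b : C.
Hypothesis smooth : 4%:R * a ^+ 3 + 27%:R * b ^+ 2 != 0.

(** Up to a constant these are the denominator and the numerator of x(2P). A Bezout identity writes
    4 a^3 + 27 b^2 as a combination of the two. *)
Lemma duplication_coprime (x : C) :
  x ^+ 3 + a * x + b = 0 -> (x ^+ 2 - a) ^+ 2 - 8%:R * b * x = 0 -> False.
Proof.
move=> e1 e2; move/eqP: smooth; apply.
transitivity ((3%:R * x ^+ 2 + 4%:R * a) * ((x ^+ 2 - a) ^+ 2 - 8%:R * b * x)
  - (3%:R * x ^+ 3 - 5%:R * a * x - 27%:R * b) * (x ^+ 3 + a * x + b)); first by ring.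
by rewrite e1 e2 !mulr0 subr0.
Qed.

(* [p / q] has the shape of the [x]-coordinate of multiplication by [n]. *)
Definition mul_shape (n : nat) (p q : {poly C}) : Prop :=
  [/\ coprimep p q, p \is monic, size p = (n ^ 2).+1, size q = (n ^ 2)%N
    & lead_coef q = (n ^ 2)%:R].

(** The common denominator and the two numerators of [chord_sum] and [chord_prod] at u = A / B,
    multiplied by B^2. *)
Let S0 (A B : {poly C}) := (A - 'X * B) ^+ 2.
Let S1 (A B : {poly C}) :=
  2%:R%:P * ((A * 'X + a%:P * B) * (A + 'X * B) + (2%:R * b)%:P * (B * B)).
Let S2 (A B : {poly C}) :=
  (A * 'X - a%:P * B) ^+ 2 - (4%:R * b)%:P * B * (A + 'X * B).

Lemma coprimep_root2 (A B : {poly C}) x :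
  coprimep A B -> A.[x] = 0 -> B.[x] = 0 -> False.
Proof.
move=> cAB Ax Bx; have := coprimep_root cAB; move/(_ x).
by rewrite rootE Ax Bx eqxx => /(_ isT).
Qed.

(** At a zero x of [S0] one has A = x B with B nonzero, and the addition formulas degenerate to
    duplication: [S1] is 4 B^2 (x^3 + a x + b) and [S2] is B^2 ((x^2 - a)^2 - 8 b x). *)
Lemma S_primitive A B x : coprimep A B ->
  (S0 A B).[x] = 0 -> (S1 A B).[x] = 0 -> (S2 A B).[x] = 0 -> False.
Proof.
rewrite /S0 /S1 /S2 => cAB.
rewrite !(hornerD, hornerN, hornerM, hornerC, hornerX, horner_exp) => /eqP.
rewrite sqrf_eq0 subr_eq0 => /eqP Ax; rewrite Ax.
have B0 : B.[x] != 0.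
  by apply/eqP => Bx; apply: (coprimep_root2 cAB _ Bx); rewrite Ax Bx mulr0.
move=> e1 e2; apply: (@duplication_coprime x).
  apply: (mulfI (_ : 4%:R * B.[x] ^+ 2 != 0)).
    by rewrite mulf_neq0 ?expf_neq0 ?pnatr_eq0.
  by rewrite mulr0 -[RHS]e1; ring.
apply: (mulfI (_ : B.[x] ^+ 2 != 0)); first by rewrite expf_neq0.
by rewrite mulr0 -[RHS]e2; ring.
Qed.

(* The triples [(1 : u' + u'' : u' u'')] for the [x]-coordinates [u'], [u''] of
   [(n + 1) P] and [(n - 1) P] and [(S0 : S1 : S2)] are both primitive, hence equal
   up to a constant; comparing degrees gives
   [deg (n + 1) + deg (n - 1) = 2 deg n + 2]. *)
Lemma degree_step k (A B Am Bm Ap Bp : {poly C}) : (0 < k)%N ->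
  mul_shape k.+1 A B -> mul_shape k Am Bm ->
  coprimep Ap Bp -> Ap \is monic -> Bp != 0 ->
  (Ap * Bm + Am * Bp) * S0 A B = S1 A B * (Bp * Bm) ->
  (Ap * Am) * S0 A B = S2 A B * (Bp * Bm) ->
  mul_shape k.+2 Ap Bp.
Proof.
move=> k0 [cAB monA szA szB lB] [cABm monAm szAm szBm lBm] cABp monAp Bp0 e1 e2.
have k2 : ((k.+1 ^ 2) = (k ^ 2) + k.*2.+1)%N by rewrite -addn1 sqrnD -addnn; clear; lia.
have kk2 : ((k.+2 ^ 2) = (k ^ 2) + k.*2.*2 + 4)%N by rewrite -addn2 sqrnD -!addnn; clear; lia.
have kpos : (0 < k ^ 2)%N by rewrite expn_gt0 k0.
have Bm0 : Bm != 0 by rewrite -size_poly_gt0 szBm.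
have B0 : B != 0 by rewrite -size_poly_gt0 szB expn_gt0.
have Am0 := monic_neq0 monAm; have Ap0 := monic_neq0 monAp.
have [||c c0 [eT0 eT2]] := @primitive_proportional _ (S0 A B) (S1 A B) (S2 A B)
  (Bp * Bm) (Ap * Bm + Am * Bp) (Ap * Am) _ _ (mulf_neq0 Bp0 Bm0) e1 e2.
- by move=> x; apply: S_primitive.
- move=> x; rewrite !hornerE => /eqP; rewrite mulf_eq0 => /orP[]/eqP Bx.
    rewrite Bx mulr0 addr0 => /eqP; rewrite mulf_eq0 => /orP[]/eqP Ax.
      by case: (coprimep_root2 cABp Ax Bx).
    move/eqP; rewrite mulf_eq0 => /orP[]/eqP Ax'.
      by case: (coprimep_root2 cABp Ax' Bx).
    exact: (coprimep_root2 cABm Ax' Ax).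
  rewrite Bx mulr0 add0r => /eqP; rewrite mulf_eq0 => /orP[]/eqP Ax.
    by case: (coprimep_root2 cABm Ax Bx).
  move/eqP; rewrite mulf_eq0 => /orP[]/eqP Ax'.
    by case: (coprimep_root2 cABp Ax' Ax).
  exact: (coprimep_root2 cABm Ax' Bx).
have szXB : size ('X * B) = (k.+1 ^ 2).+1 by rewrite mulrC size_mulX // szB.
have [szS2 monS2] : size (S2 A B) = (2 * k.+1 ^ 2 + 3)%N /\ S2 A B \is monic.
  have sz1 : (size (a%:P * B)%R <= k.+1 ^ 2)%N by rewrite mul_polyC -szB size_scale_leq.
  have sz2 : size (A * 'X) = (k.+1 ^ 2).+2 by rewrite size_mulX ?monic_neq0 // szA.
  have sz3 : (size (- (a%:P * B))%R < size (A * 'X)%R)%N by rewrite size_polyN sz2 ltnS ltnW // ltnS.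
  have mon1 : A * 'X - a%:P * B \is monic.
    by rewrite monicE lead_coefDl // -monicE monicMl ?monicX.
  have sz4 : size (A * 'X - a%:P * B) = (k.+1 ^ 2).+2 by rewrite size_polyDl.
  have sz5 : size ((A * 'X - a%:P * B) ^+ 2) = (2 * k.+1 ^ 2 + 3)%N.
    by rewrite expr2 size_monicM ?monic_neq0 // sz4; move: (k.+1 ^ 2)%N => N; clear; lia.
  have sz6 : (size (A + 'X * B)%R <= (k.+1 ^ 2).+1)%N.
    by rewrite (leq_trans (size_polyD _ _)) // szA szXB maxnn.
  have sz7 : (size (- ((4%:R * b)%:P * B * (A + 'X * B)))%R <
     size ((A * 'X - a%:P * B) ^+ 2)%R)%N.
    rewrite size_polyN sz5; apply: leq_ltn_trans (size_polyMleq _ _) _.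
    have : (size ((4%:R * b)%:P * B)%R <= k.+1 ^ 2)%N.
      by rewrite mul_polyC -szB size_scale_leq.
    by move: sz6; clear; move: (size _) (size _) (k.+1 ^ 2)%N; lia.
  split; first by rewrite /S2 size_polyDl.
  by rewrite monicE /S2 lead_coefDl // -monicE expr2 monicMl.
(* [Ap], [Am] and [S2] are all monic. *)
have c1 : c = 1.
  have : lead_coef (Ap * Am) = lead_coef (c *: S2 A B) by rewrite eT2.
  rewrite lead_coefZ (monicP monS2) mulr1 => <-.
  by apply/monicP; rewrite monicMl.
rewrite c1 !scale1r in eT0 eT2.
have szAp : size Ap = (k.+2 ^ 2).+1.
  have : size (Ap * Am) = size (S2 A B) by rewrite eT2.
  by rewrite size_monicM // szS2 szAm; move: k2 kk2; clear; move: (size _); lia.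
(* A and X B both have degree n^2 for n = k + 1, with leading coefficients 1 and n^2; these do not
   cancel as n > 1. *)
have lS : (A - 'X * B)`_(k.+1 ^ 2) = 1 - (k.+1 ^ 2)%:R.
  rewrite coefB; congr (_ - _).
    by rewrite -(monicP monA) /lead_coef szA.
  by rewrite mulrC coefMX -lB /lead_coef szB; move: (expn_gt0 k.+1 2); case: (k.+1 ^ 2)%N.
have n1 : (1 - (k.+1 ^ 2)%:R : C) != 0.
  rewrite subr_eq0 -[1]/(1%:R) eqr_nat; move: k2 kpos k0; clear; lia.
have szS : size (A - 'X * B) = (k.+1 ^ 2).+1.
  apply/eqP; rewrite eqn_leq; apply/andP; split.
    by rewrite (leq_trans (size_polyD _ _)) // size_polyN szA szXB maxnn.
  by rewrite ltnNge; apply/negP => /leq_sizeP/(_ _ (leqnn _)) /eqP; rewrite lS (negPf n1).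
have S00 : A - 'X * B != 0 by rewrite -size_poly_gt0 szS.
have szBp : size Bp = (k.+2 ^ 2)%N.
  have : size (Bp * Bm) = size (S0 A B) by rewrite eT0.
  rewrite size_mul // szBm /S0 expr2 size_mul // szS.
  by move: Bp0; rewrite -size_poly_gt0; move: k2 kk2 kpos; clear; move: (size _); lia.
split=> //.
(* With n = k + 1, (1 - n^2)^2 = (n - 1)^2 (n + 1)^2; cancelling (n - 1)^2 leaves (k + 2)^2. *)
have : lead_coef Bp * (k ^ 2)%:R = (1 - (k.+1 ^ 2)%:R) ^+ 2.
  by rewrite -lBm -lead_coefM eT0 /S0 expr2 lead_coefM /lead_coef szS lS.
have kn0 : (k ^ 2)%:R != 0 :> C by rewrite pnatr_eq0 -lt0n.
move=> e; apply: (mulIf kn0); rewrite e.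
rewrite !natrX -[k.+2]addn2 -[k.+1]addn1 !natrD; ring.
Qed.

End DegreeStep.

(** * Multiples of the generic point *)

Lemma chord_frac (L : fieldType) (X F p r q : L) : q != 0 -> p - X * q != 0 ->
  let s := p - X * q in
  let la := (r / q - 1) / (p / q - X) in
  let u3 := F * la ^+ 2 - p / q - X in
  let p3 := F * (r - q) ^+ 2 * q - p * s ^+ 2 - X * q * s ^+ 2 in
  u3 = p3 * s / (q * s ^+ 3) /\
  la * (X - u3) - 1 = ((r - q) * (X * q * s ^+ 2 - p3) - q * s ^+ 3) / (q * s ^+ 3).
Proof. by move=> q0 s0 /=; split; field; rewrite ?q0 ?s0. Qed.

Lemma tangent_frac (L : fieldType) (X F d : L) : F != 0 -> 2%:R != 0 :> L ->
  let la := d / (2%:R * F) in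
  let u3 := F * la ^+ 2 - X - X in
  u3 = 2%:R * F * (d ^+ 2 - 8%:R * X * F) / (8%:R * F ^+ 2) /\
  la * (X - u3) - 1 =
    (d * (12%:R * X * F - d ^+ 2) - 8%:R * F ^+ 2) / (8%:R * F ^+ 2).
Proof.
move=> F0 t0 /=.
have e0 : 8%:R != 0 :> L by rewrite -[8%N]/(2 ^ 3)%N natrX expf_neq0.
by split; field; rewrite ?e0 ?F0 ?t0.
Qed.

(** This is (Q + P) - P = Q on x-coordinates, with u' = x(Q): the chord through Q + P and -P is the
    mirror image of the one through Q and P, hence has slope -[la]. *)
Lemma reverse_chord (L : fieldType) (X F la u' : L) :
  let u := F * la ^+ 2 - u' - X in let v := la * (X - u) - 1 in
  u - X != 0 -> F * ((v + 1) / (u - X)) ^+ 2 - u - X = u'.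
Proof.
move=> u v u0; have -> : (v + 1) / (u - X) = - la.
  by rewrite /v; field.
by rewrite /u sqrrN; ring.
Qed.

Lemma doubling_x (L : fieldType) (X F a b : L) : F = X ^+ 3 + a * X + b ->
  F != 0 -> 2%:R != 0 :> L ->
  F * ((3%:R * X ^+ 2 + a) / (2%:R * F)) ^+ 2 - X - X =
  ((X ^+ 2 - a) ^+ 2 - 8%:R * b * X) / (4%:R * F).
Proof.
move=> FE F0 t0; have -> : b = F - X ^+ 3 - a * X by rewrite FE; ring.
have f0 : 4%:R != 0 :> L by rewrite -[4%N]/(2 ^ 2)%N natrX expf_neq0.
by field; rewrite F0 t0 f0.
Qed.

Lemma ec_mulS (C : numClosedFieldType) (E : elliptic_curve C) n (P : point E) :
  ec_mul n.+1 P = ec_add P (ec_mul n P).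
Proof. by []. Qed.

Section GenericMultiples.
Variable C : numClosedFieldType.
Variable E : elliptic_curve C.
Local Notation K := (ratfun C).
Local Notation a := (ec_a E).
Local Notation b := (ec_b E).
Local Notation X := ('X%:F : K).

Definition wpoly : {poly C} := 'X ^+ 3 + a%:P * 'X + b%:P.
Local Notation F := (wpoly%:F : K).

Lemma wpolyE : F = X ^+ 3 + cst a * X + cst b.
Proof. by rewrite /wpoly !rmorphD !rmorphM. Qed.

Lemma horner_wpoly x : wpoly.[x] = x ^+ 3 + a * x + b.
Proof. by rewrite /wpoly !(hornerD, hornerM, hornerC, horner_exp, hornerX). Qed.

Lemma size_wpoly : size wpoly = 4%N /\ wpoly \is monic.
Proof.
have sz : (size (a%:P * 'X + b%:P)%R < size ('X ^+ 3 : {poly C})%R)%N.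
  rewrite size_polyXn size_MXaddC; case: ifP => // _.
  by rewrite !ltnS (leq_trans (size_polyC_leq1 _)).
rewrite /wpoly -addrA; split; first by rewrite size_polyDl // size_polyXn.
by rewrite monicE lead_coefDl // -monicE monicXn.
Qed.

Lemma wpoly_neq0 : wpoly != 0.
Proof. by rewrite monic_neq0 //; case: size_wpoly. Qed.

Lemma deriv_wpoly : wpoly^`() = 3%:R%:P * 'X ^+ 2 + a%:P.
Proof.
rewrite /wpoly !(derivD, derivM, derivC, derivXn, derivX).
by rewrite mul0r add0r mulr1 addr0 polyC_natr mulr_natl.
Qed.

Lemma cst_natr n : n%:R = cst n%:R :> K.
Proof. by rewrite rmorph_nat. Qed.

Lemma dfrac_natr n : dfrac (n%:R : K) = 0.
Proof. by rewrite cst_natr dfrac_cst. Qed.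

Lemma dfrac1 : dfrac (1 : K) = 0.
Proof. exact: (dfrac_natr 1). Qed.

Lemma dfracMn n (g : K) : dfrac (n%:R * g) = n%:R * dfrac g.
Proof. by rewrite dfracM dfrac_natr mul0r add0r. Qed.

Lemma natr_inj m n : m%:R = n%:R :> K -> m = n.
Proof.
rewrite !cst_natr => /fmorph_inj /eqP; rewrite eqr_nat; exact: eqP.
Qed.

Lemma natrK_eq0 n : (n%:R == 0 :> K) = (n == 0)%N.
Proof. by apply/eqP/eqP => [/(@natr_inj _ 0)|->]. Qed.

Lemma F_neq0 : F != 0. Proof. by rewrite tofrac_eq0 wpoly_neq0. Qed.

Lemma dfrac_F : dfrac F = 3%:R * X ^+ 2 + cst a.
Proof.
by rewrite dfrac_poly deriv_wpoly rmorphD rmorphM rmorphXn /= -/(cst _) -cst_natr.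
Qed.

(* A pair [(u, v)] stands for the point [(u, v * y)] of E over the function
   field [C(x)(y)], [y ^ 2 = F]: it lies on the quadratic twist
   [F v^2 = u^3 + a u + b], so that no extension of [ratfun C] is needed.
   [gen_add] adds the generic point [(X, y)], and [gen_mul k] is the multiple of
   the generic point by [k + 1]. *)
Definition gen_add (P : K * K) : K * K :=
  let la := if P.1 == X then (3%:R * X ^+ 2 + cst a) / (2%:R * F)
            else (P.2 - 1) / (P.1 - X) in
  let u := F * la ^+ 2 - P.1 - X in (u, la * (X - u) - 1).

Definition gen_mul k : K * K := iter k gen_add (X, 1).

Arguments gen_mul : simpl never.

Lemma gen_mulS k : gen_mul k.+1 = gen_add (gen_mul k).
Proof. by []. Qed.

Definition on_twist (P : K * K) := F * P.2 ^+ 2 = P.1 ^+ 3 + cst a * P.1 + cst b.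

(* Invariance of the differential dx / y: it is multiplied by n under [n]. *)
Definition scales_differential (n : nat) (P : K * K) :=
  dfrac P.1 = n%:R * P.2 /\
  2%:R * F * dfrac P.2 =
    n%:R * (3%:R * P.1 ^+ 2 + cst a) - (3%:R * X ^+ 2 + cst a) * P.2.

Lemma dfrac_third la u : dfrac (F * la ^+ 2 - u - X) =
  (3%:R * X ^+ 2 + cst a) * la ^+ 2 + F * (2%:R * la * dfrac la) - dfrac u - 1.
Proof. by rewrite !dfracB dfrac_X dfracM dfrac_F dfracXn expr1. Qed.

Lemma gen_add_step n P : on_twist P -> scales_differential n P ->
  P = (X, 1) /\ n = 1%N \/ P.1 != X ->
  on_twist (gen_add P) /\ scales_differential n.+1 (gen_add P).
Proof.
have two0 : 2%:R != 0 :> K by rewrite natrK_eq0.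
move: P => [u v]; rewrite /on_twist /scales_differential /=.
move=> curve [du dv] [[[-> ->] ->]|uX]; rewrite /gen_add /=.
  rewrite eqxx; set la := _ / _.
  have dla : dfrac la = (6%:R * X * (2%:R * F) -
     (3%:R * X ^+ 2 + cst a) * (2%:R * (3%:R * X ^+ 2 + cst a))) / (2%:R * F) ^+ 2.
    have d0 : 2%:R * F != 0 := mulf_neq0 two0 F_neq0.
    rewrite (dfrac_div _ d0).
    rewrite dfracMn dfrac_F dfracD dfracMn dfracXn dfrac_X dfrac_cst addr0 mulr1 expr1.
    by rewrite [3%:R * (_ * X)]mulrA -natrM.
  have eX : F * la ^+ 2 - X - X = F * la ^+ 2 - 2%:R * X.
    by rewrite mulr_natl mulr2n opprD addrA.
  have ed : dfrac (F * la ^+ 2 - 2%:R * X) =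
     (3%:R * X ^+ 2 + cst a) * la ^+ 2 + F * (2%:R * la * dfrac la) - 2%:R.
    by rewrite -eX dfrac_third dfrac_X -addrA -opprD.
  rewrite eX; split; first exact: tangent_curve wpolyE two0 F_neq0.
  split; first by rewrite ed dla (tangent_du _ _ two0 F_neq0).
  rewrite dfracB dfrac1 subr0 dfracM dfracB dfrac_X ed dla.
  exact: (tangent_dv _ _ two0 F_neq0).
rewrite (negPf uX); rewrite -subr_eq0 in uX.
set la := _ / _.
have dla : dfrac la = (dfrac v * (u - X) - (v - 1) * (n%:R * v - 1)) / (u - X) ^+ 2.
  by rewrite /la dfrac_div // !dfracB du dfrac_X dfrac1 subr0.
split; first exact: chord_curve wpolyE uX curve.
split=> /=.
  rewrite dfrac_third du dla -[n.+1%:R]natr1.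
  exact: (chord_du wpolyE two0 F_neq0 uX curve dv).
rewrite dfracB dfrac1 subr0 dfracM dfracB dfrac_X dfrac_third du dla.
by rewrite -[n.+1%:R]natr1; exact: (chord_dv wpolyE two0 F_neq0 uX curve dv).
Qed.

(** If u = X, then v^2 = 1, and u' = n v reads 1 = n or 1 = -n, which is impossible in
    characteristic 0 for n > 1. Hence the tangent formula occurs only in the doubling of the generic
    point. *)
Lemma twist_x_neq n P : (1 < n)%N -> on_twist P -> scales_differential n P -> P.1 != X.
Proof.
case: P => u v n1 curve [/= du _]; apply/eqP => uX.
move: curve; rewrite /on_twist /= uX -wpolyE => /eqP.
rewrite -[X in _ == X]mulr1 (inj_eq (mulfI F_neq0)) sqrf_eq1 => /orP[]/eqP vE.
  by move: du; rewrite uX dfrac_X vE mulr1 => /(@natr_inj 1) e; rewrite -e in n1.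
move: du; rewrite uX dfrac_X vE mulrN1 => /eqP.
by rewrite -addr_eq0 nat1r natrK_eq0.
Qed.

Lemma gen_mulP k :
  on_twist (gen_mul k) /\ scales_differential k.+1 (gen_mul k).
Proof.
elim: k => [|k [IH1 IH2]].
  rewrite /gen_mul /on_twist /scales_differential /= dfrac_X dfrac1.
  by rewrite rmorph1 mul1r mulr1 expr1n !mulr1 -wpolyE mulr0 mul1r subrr.
rewrite gen_mulS; apply: gen_add_step => //.
case: k IH1 IH2 => [|k] IH1 IH2; [by left|right].
exact: twist_x_neq IH1 IH2.
Qed.

Lemma gen_mul_x_neq k : (gen_mul k.+1).1 != X.
Proof. by have [h1 h2] := gen_mulP k.+1; apply: twist_x_neq h1 h2. Qed.

Lemma gen_mul_diff k :
  dfrac (gen_mul k).1 ^+ 2 * F =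
  (k.+1 ^ 2)%:R * ((gen_mul k).1 ^+ 3 + cst a * (gen_mul k).1 + cst b).
Proof.
have [h1 [h2 _]] := gen_mulP k.
by rewrite h2 -h1 exprMn -natrX -mulrA [_ * F]mulrC.
Qed.

(** The fractions are deliberately left unreduced: q collects every divisor met on the way, so q(x)
    != 0 ensures both that the earlier formulas hold at x and that [raw_add] takes the same branch
    as [gen_add]. *)
Lemma gen_mul_specialize k : exists p r q : {poly C},
  [/\ q != 0, (gen_mul k).1 = p%:F / q%:F, (gen_mul k).2 = r%:F / q%:F &
   forall (P : point E) x y, pt P = Some (x, y) -> q.[x] != 0 ->
     pt (ec_mul k.+1 P) = Some (p.[x] / q.[x], r.[x] / q.[x] * y)].
Proof.
have two0 : 2%:R != 0 :> K by rewrite natrK_eq0.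
elim: k => [|[|k] [p [r [q [q0 uE vE IH]]]]].
- exists 'X, 1, 1; rewrite oner_eq0 rmorph1 !divr1; split=> //.
  move=> P x y PE _; rewrite /ec_mul /= PE.
  by rewrite hornerX hornerC !divr1 mul1r.
- set d := 3%:R%:P * 'X ^+ 2 + a%:P : {poly C}.
  (* The factor 2 F in the first numerator gives both coordinates the denominator 8 F^2. *)
  exists (2%:R%:P * wpoly * (d ^+ 2 - 8%:R%:P * 'X * wpoly)),
    (d * (12%:R%:P * 'X * wpoly - d ^+ 2) - 8%:R%:P * wpoly ^+ 2),
    (8%:R%:P * wpoly ^+ 2).
  have dE : d%:F = 3%:R * X ^+ 2 + cst a.
    by rewrite rmorphD rmorphM rmorphXn /= -/(cst _) -cst_natr.
  have [e1 e2] := tangent_frac X d%:F F_neq0 two0.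
  split.
  + by rewrite mulf_neq0 ?expf_neq0 ?wpoly_neq0 // polyC_eq0 pnatr_eq0.
  + rewrite /gen_mul /gen_add /= eqxx -dE e1.
    by rewrite !(rmorphM, rmorphB, rmorphXn) /= -!/(cst _) -!cst_natr.
  + rewrite /gen_mul /gen_add /= eqxx -dE e2.
    by rewrite !(rmorphM, rmorphB, rmorphXn) /= -!/(cst _) -!cst_natr.
  + move=> P x y PE.
    rewrite !(hornerD, hornerN, hornerM, hornerC, horner_exp, hornerX) -!horner_wpoly.
    rewrite mulf_eq0 => /norP[_]; rewrite sqrf_eq0 => w0.
    have wy : wpoly.[x] = y ^+ 2.
      by have := pt_on_curve P; rewrite PE horner_wpoly => /eqP.
    rewrite wy in w0; have y0 : y != 0 by rewrite sqrf_eq0 in w0.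
    have two : 2%:R != 0 :> C by rewrite pnatr_eq0.
    have [f1 f2] := tangent_frac x (3%:R * x ^+ 2 + a) w0 two.
    rewrite /ec_mul /= PE /= eqxx /=.
    have -> : (y == - y) = false.
      by apply/negbTE; rewrite -addr_eq0 -mulr2n -mulr_natl mulf_neq0.
    rewrite wy -f1 -f2 /chord_tangent; congr (Some (_, _)).
      by field; rewrite y0.
    by field; rewrite y0.
have q0' : q%:F != 0 :> K by rewrite tofrac_eq0.
have s0 : p - 'X * q != 0.
  apply: contra (gen_mul_x_neq k); rewrite subr_eq0 => /eqP e.
  by rewrite uE e rmorphM (mulfK q0') eqxx.
set s := p - 'X * q in s0.
have sE : s%:F = p%:F - X * q%:F by rewrite rmorphB rmorphM.
have s0' : p%:F - X * q%:F != 0 by rewrite -sE tofrac_eq0.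
set p3 := wpoly * (r - q) ^+ 2 * q - p * s ^+ 2 - 'X * q * s ^+ 2.
exists (p3 * s), ((r - q) * ('X * q * s ^+ 2 - p3) - q * s ^+ 3), (q * s ^+ 3).
have [e1 e2] := chord_frac F r%:F q0' s0'.
split.
- by rewrite mulf_neq0 ?expf_neq0.
- rewrite gen_mulS /gen_add (negPf (gen_mul_x_neq k)) uE vE [LHS]e1.
  by rewrite !(rmorphM, rmorphB, rmorphXn).
- rewrite gen_mulS /gen_add (negPf (gen_mul_x_neq k)) uE vE [LHS]e2.
  by rewrite !(rmorphM, rmorphB, rmorphXn).
move=> P x y PE.
have sx : s.[x] = p.[x] - x * q.[x] by rewrite !(hornerD, hornerN, hornerM, hornerX).
rewrite hornerM horner_exp mulf_eq0 => /norP[qx]; rewrite expf_eq0 => sx0.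
rewrite ec_mulS -[pt _]/(raw_add E (pt P) (pt (ec_mul k.+2 P))) PE (IH P x y PE qx) /=.
rewrite sx in sx0; have {}sx0 : p.[x] - x * q.[x] != 0 := sx0.
have -> : (x != p.[x] / q.[x]).
  by apply: contra sx0 => /eqP e; rewrite {2}e divfK // subrr.
have wy : wpoly.[x] = y ^+ 2.
  by have := pt_on_curve P; rewrite PE horner_wpoly => /eqP.
have [/= f1 f2] := chord_frac (y ^+ 2) r.[x] qx sx0.
rewrite /p3 !(hornerD, hornerN, hornerM, hornerC, horner_exp, hornerX) -!horner_wpoly wy.
rewrite -f1 -f2 /chord_tangent.
set u := p.[x] / q.[x]; set v := r.[x] / q.[x].
have -> : (v * y - y) / (u - x) = (v - 1) / (u - x) * y.
  by rewrite [RHS]mulrAC [(v - 1) * y]mulrBl mul1r.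
by move: ((v - 1) / _) => t; congr (Some (_, _)); ring.
Qed.

Lemma pullback_gen_mul k (i : {rmorphism K -> K}) :
  is_pullback (lattes E k.+1) i -> i X = (gen_mul k).1.
Proof.
move=> iP; have [p [r [q [q0 uE _ spec]]]] := gen_mul_specialize k.
apply: (evalP1_inj_cofinite q0) => x qx.
rewrite (evalP1_pullback_X iP) uE evalP1_frac //.
by rewrite /lattes /ec_pi (spec (ec_lift E (Some x)) _ _ erefl qx).
Qed.

End GenericMultiples.

Lemma clear_sum (L : fieldType) (X a b A B Ap Bp Am Bm : L) :
  B != 0 -> Bp != 0 -> Bm != 0 -> A / B - X != 0 ->
  Ap / Bp + Am / Bm =
    2%:R * ((A / B * X + a) * (A / B + X) + 2%:R * b) / (A / B - X) ^+ 2 ->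
  (Ap * Bm + Am * Bp) * (A - X * B) ^+ 2 =
    2%:R * ((A * X + a * B) * (A + X * B) + 2%:R * b * (B * B)) * (Bp * Bm).
Proof.
move=> B0 Bp0 Bm0 d0 e.
have -> : Ap * Bm + Am * Bp = (Ap / Bp + Am / Bm) * (Bp * Bm).
  by field; rewrite ?Bp0 ?Bm0.
have {d0}d0 : A - X * B != 0.
  by apply: contraNneq d0 => /eqP; rewrite subr_eq0 => /eqP ->; rewrite mulfK ?subrr.
by rewrite e; field; rewrite B0 mulNr.
Qed.

Lemma clear_prod (L : fieldType) (X a b A B Ap Bp Am Bm : L) :
  B != 0 -> Bp != 0 -> Bm != 0 -> A / B - X != 0 ->
  Ap / Bp * (Am / Bm) =
    ((A / B * X - a) ^+ 2 - 4%:R * b * (A / B + X)) / (A / B - X) ^+ 2 ->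
  (Ap * Am) * (A - X * B) ^+ 2 =
    ((A * X - a * B) ^+ 2 - 4%:R * b * B * (A + X * B)) * (Bp * Bm).
Proof.
move=> B0 Bp0 Bm0 d0 e.
have -> : Ap * Am = Ap / Bp * (Am / Bm) * (Bp * Bm).
  by field; rewrite ?Bp0 ?Bm0.
have {d0}d0 : A - X * B != 0.
  by apply: contraNneq d0 => /eqP; rewrite subr_eq0 => /eqP ->; rewrite mulfK ?subrr.
by rewrite e; field; rewrite B0 mulNr.
Qed.

Section Shape.
Variable C : numClosedFieldType.
Variable E : elliptic_curve C.
Local Notation K := (ratfun C).
Local Notation a := (ec_a E).
Local Notation b := (ec_b E).
Local Notation X := ('X%:F : K).
Local Notation F := ((wpoly E)%:F : K).

Lemma cst_natM n (c : C) : cst (n%:R * c) = n%:R * cst c.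
Proof. by rewrite rmorphM /= rmorph_nat. Qed.

(** Allows the numerator to be made monic. If u = 0, then u' = n v gives v = 0, and the equations
    for F v^2 and for v' leave b = 0 and a = 0, against smoothness. *)
Lemma gen_mul_x_neq0 k : (gen_mul E k).1 != 0.
Proof.
have [tw [d1 d2]] := gen_mulP E k; apply/eqP => u0.
have n0 : k.+1%:R != 0 :> K by rewrite natrK_eq0.
have v0 : (gen_mul E k).2 = 0.
  by apply: (mulfI n0); rewrite -d1 u0 mulr0 -(rmorph0 (@cst C)) dfrac_cst.
move: tw d2; rewrite /on_twist u0 v0 !expr0n /= !mulr0 !add0r => /esym b0.
rewrite -{1}(rmorph0 (@cst C)) dfrac_cst mulr0 subr0 => /esym/eqP.
rewrite mulf_eq0 (negPf n0) /= => /eqP a0.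
have aE : a = 0 by apply: (fmorph_inj (@cst C)); rewrite rmorph0.
have bE : b = 0 by apply: (fmorph_inj (@cst C)); rewrite rmorph0.
by have := ec_smooth E; rewrite aE bE !expr0n /= !mulr0 addr0 eqxx.
Qed.

Lemma monic_frac (g : K) : g != 0 -> exists p q : {poly C},
  [/\ coprimep p q, p \is monic, q != 0 & g = p%:F / q%:F].
Proof.
move=> g0; have n0 : numer g != 0.
  by apply: contraNneq g0 => n0; rewrite (numer_denomE g) n0 rmorph0 mul0r.
set c := (lead_coef (numer g))^-1.
have c0 : c != 0 by rewrite invr_eq0 lead_coef_eq0.
exists (c *: numer g), (c *: denom g); split.
- by rewrite coprimepZl // coprimepZr // coprime_numer_denom.
- by rewrite monicE lead_coefZ mulVf // lead_coef_eq0.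
- by rewrite scaler_eq0 negb_or c0 denom_neq0.
- rewrite -!mul_polyC ![c%:P * _]mulrC frac_common ?polyC_eq0 //.
  exact: numer_denomE.
Qed.

Lemma wpoly_coprime :
  coprimep (('X ^+ 2 - a%:P) ^+ 2 - (8%:R * b)%:P * 'X) (4%:R%:P * wpoly E).
Proof.
rewrite [4%:R%:P * _]mul_polyC coprimepZr ?pnatr_eq0 // coprimep_def.
apply/negbNE/negP => /closed_rootP[x]; rewrite root_gcd !rootE horner_wpoly.
rewrite !(hornerD, hornerN, hornerM, hornerC, horner_exp, hornerX).
by move=> /andP[/eqP e1 /eqP e2]; exact: (duplication_coprime (ec_smooth E) e2 e1).
Qed.

(** There are two base cases because the multiple n + 1 is reached from n and n - 1, and n - 1 = 0
    would be the point at infinity, which has no x-coordinate. *)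
Lemma gen_mul_shape k : exists p q : {poly C},
  mul_shape k.+1 p q /\ (gen_mul E k).1 = p%:F / q%:F.
Proof.
have two0 : 2%:R != 0 :> K by rewrite natrK_eq0.
have F0 := F_neq0 E.
elim/ltn_ind: k => -[|[|k]] IH.
- exists 'X, 1; split; last by rewrite rmorph1 divr1.
  by split; rewrite ?coprimep1 ?monicX ?size_polyX ?size_poly1 ?lead_coef1.
- exists (('X ^+ 2 - a%:P) ^+ 2 - (8%:R * b)%:P * 'X), (4%:R%:P * wpoly E).
  have [szw monw] := size_wpoly E.
  have four0 : 4%:R != 0 :> C by rewrite pnatr_eq0.
  have sz1 : size ('X ^+ 2 - a%:P) = 3%N.
    by rewrite size_polyDl size_polyXn // size_polyN (leq_ltn_trans (size_polyC_leq1 _)).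
  have mon1 : 'X ^+ 2 - a%:P \is monic.
    rewrite monicE lead_coefDl ?lead_coefXn //.
    by rewrite size_polyXn size_polyN (leq_ltn_trans (size_polyC_leq1 _)).
  have sz2 : size (('X ^+ 2 - a%:P) ^+ 2) = 5%N.
    by rewrite expr2 size_monicM ?monic_neq0 // sz1.
  have sz3 : (size (- ((8%:R * b)%:P * 'X))%R < size (('X ^+ 2 - a%:P) ^+ 2)%R)%N.
    rewrite sz2 size_polyN mul_polyC (leq_ltn_trans (size_scale_leq _ _)) //.
    by rewrite size_polyX.
  split; [split|].
  + exact: wpoly_coprime.
  + by rewrite monicE lead_coefDl // -monicE expr2 monicMl.
  + by rewrite size_polyDl // sz2.
  + by rewrite mul_polyC size_scale // szw.
  + by rewrite lead_coefM lead_coefC (monicP monw) mulr1.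
  rewrite gen_mulS /gen_add eqxx (doubling_x (wpolyE E) F0 two0).
  rewrite (rmorphM _ 4%:R%:P) rmorphB rmorphXn rmorphB rmorphXn rmorphM /=.
  by rewrite -!/(cst _) -cst_natr cst_natM.
have [Am [Bm [shm um]]] := IH k (ltnW (ltnSn _)).
have [A [B [sh uE]]] := IH k.+1 (ltnSn _).
have uX := gen_mul_x_neq E k; rewrite -subr_eq0 in uX.
have [tw _] := gen_mulP E k.+1.
have [Ap [Bp [cAB monAp Bp0 upE]]] := monic_frac (gen_mul_x_neq0 k.+2).
exists Ap, Bp; split=> //.
have upE' : (gen_mul E k.+2).1 =
   F * (((gen_mul E k.+1).2 - 1) / ((gen_mul E k.+1).1 - X)) ^+ 2 -
   (gen_mul E k.+1).1 - X.
  by rewrite (gen_mulS E k.+1) /gen_add (negPf (gen_mul_x_neq E k)).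
have umE' : (gen_mul E k).1 =
   F * (((gen_mul E k.+1).2 + 1) / ((gen_mul E k.+1).1 - X)) ^+ 2 -
   (gen_mul E k.+1).1 - X.
  by rewrite gen_mulS; apply/esym/reverse_chord; rewrite gen_mulS in uX.
have sumE := chord_sum (wpolyE E) tw uX.
have prodE := chord_prod (wpolyE E) tw uX.
rewrite -upE' -umE' upE um uE in sumE prodE; rewrite uE in uX.
have [B0 Bm0] : B != 0 /\ Bm != 0.
  case: sh shm => _ _ _ szB _ [_ _ _ szBm _].
  by rewrite -!size_poly_gt0 szB szBm !expn_gt0.
have fr p : p != 0 -> p%:F != 0 :> K by rewrite tofrac_eq0.
apply: (degree_step (ec_smooth E) _ sh shm cAB monAp Bp0) => //.
  apply/eqP; rewrite -tofrac_eq; apply/eqP.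
  have := clear_sum (fr _ B0) (fr _ Bp0) (fr _ Bm0) uX sumE.
  by rewrite !(tofracXn, tofracM, tofracB, tofracD) -!/(cst _) -!cst_natr cst_natM.
apply/eqP; rewrite -tofrac_eq; apply/eqP.
have := clear_prod (fr _ B0) (fr _ Bp0) (fr _ Bm0) uX prodE.
by rewrite !(tofracXn, tofracM, tofracB, tofracD) -!/(cst _) cst_natM.
Qed.

End Shape.

(** * Valuations of the rational function field *)

Section Valuations.
Variable C : closedFieldType.
Local Notation K := (ratfun C).
Local Notation X := ('X%:F : K).
Implicit Types (p q : {poly C}) (g h : K) (v w : K -> int).

Lemma XsubC_frac (z : C) : X - cst z = ('X - z%:P)%:F.
Proof. by rewrite rmorphB. Qed.

Lemma XsubC_frac_neq0 (z : C) : X - cst z != 0.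
Proof. by rewrite XsubC_frac tofrac_eq0 polyXsubC_eq0. Qed.

(** Weaker than being a valuation, so that multiples of a valuation and its composite with a
    pullback qualify; over an algebraically closed field such a function is still determined by its
    values at the X - z. *)
Definition trivial_on_constants v :=
  (forall x y, x != 0 -> y != 0 -> v (x * y) = v x + v y) /\
  (forall c, c != 0 -> v (cst c) = 0).

Lemma trivial_on_constants_eq v w :
  trivial_on_constants v -> trivial_on_constants w ->
  (forall z, v (X - cst z) = w (X - cst z)) -> forall g, g != 0 -> v g = w g.
Proof.
move=> [vM vC] [wM wC] vw.
have prod (s : seq C) : v (\prod_(z <- s) ('X - z%:P))%:F = w (\prod_(z <- s) ('X - z%:P))%:F.
  elim: s => [|z s IH].
    by rewrite big_nil -[1 in LHS]/(1%:P) -[1 in RHS]/(1%:P) -/(cst _) vC ?wC ?oner_eq0.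
  have s0 : (\prod_(z <- s) ('X - z%:P))%:F != 0 :> K.
    by rewrite tofrac_eq0 monic_neq0 // monic_prod_XsubC.
  rewrite big_cons tofracM -XsubC_frac.
  by rewrite (vM _ _ (XsubC_frac_neq0 z) s0) (wM _ _ (XsubC_frac_neq0 z) s0) vw IH.
have pol p : p != 0 -> v p%:F = w p%:F.
  move=> p0; have [s ->] := closed_field_poly_normal p.
  have l0 : lead_coef p != 0 by rewrite lead_coef_eq0.
  have c0 : cst (lead_coef p) != 0 by rewrite fmorph_eq0.
  have s0 : (\prod_(z <- s) ('X - z%:P))%:F != 0 :> K.
    by rewrite tofrac_eq0 monic_neq0 // monic_prod_XsubC.
  rewrite -mul_polyC tofracM -/(cst _).
  by rewrite (vM _ _ c0 s0) (wM _ _ c0 s0) (vC _ l0) (wC _ l0) prod.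
move=> g /fracP_neq0[p [q [p0 q0 ->]]].
have q0' : q%:F != 0 :> K by rewrite tofrac_eq0.
have p0' : p%:F != 0 :> K by rewrite tofrac_eq0.
have pq0 : p%:F / q%:F != 0 :> K := mulf_neq0 p0' (etrans (congr1 negb (invr_eq0 _)) q0').
have := vM _ _ pq0 q0'; have := wM _ _ pq0 q0'.
by rewrite (divfK q0') (pol _ p0) (pol _ q0) => -> /addIr.
Qed.

Lemma trivial_on_constantsZ (k : int) v :
  trivial_on_constants v -> trivial_on_constants (fun g => k * v g).
Proof.
move=> [vM vC]; split=> [x y x0 y0|c c0]; first by rewrite vM // mulrDr.
by rewrite vC // mulr0.
Qed.

Lemma mupD_geq (a : C) p q n : p != 0 -> q != 0 -> p + q != 0 ->
  (n <= mup a p)%N -> (n <= mup a q)%N -> (n <= mup a (p + q))%N.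
Proof. by move=> p0 q0 pq0; rewrite !mup_geq //; exact: dvdp_add. Qed.

Lemma ordP1M (x : P1 C) g h : g != 0 -> h != 0 ->
  ordP1 x (g * h) = ordP1 x g + ordP1 x h.
Proof.
move=> /fracP_neq0[p [q [p0 q0 ->]]] /fracP_neq0[p' [q' [p'0 q'0 ->]]].
rewrite mulf_div -!tofracM; case: x => [a|].
  by rewrite !ordP1_frac ?mulf_neq0 // !mupM //; lia.
rewrite !ordP1_infty ?mulf_neq0 // !size_mul //.
move: p0 q0 p'0 q'0; rewrite -!size_poly_gt0.
by move: (size p) (size q) (size p') (size q'); lia.
Qed.

Lemma ordP1D (x : P1 C) g h : g != 0 -> h != 0 -> g + h != 0 ->
  Num.min (ordP1 x g) (ordP1 x h) <= ordP1 x (g + h).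
Proof.
move=> /fracP_neq0[p [q [p0 q0 ->]]] /fracP_neq0[p' [q' [p'0 q'0 ->]]].
have q0F : q%:F != 0 :> K by rewrite tofrac_eq0.
have q'0F : q'%:F != 0 :> K by rewrite tofrac_eq0.
rewrite (addf_div _ _ q0F q'0F) -!tofracM -tofracD => s0.
have {}s0 : p * q' + p' * q != 0.
  by apply: contraNneq s0 => ->; rewrite rmorph0 mul0r.
have pq' : p * q' != 0 by rewrite mulf_neq0.
have p'q : p' * q != 0 by rewrite mulf_neq0.
case: x => [a|].
  rewrite !ordP1_frac ?mulf_neq0 // !mupM //.
  have := @mupD_geq a _ _ (minn (mup a (p * q')) (mup a (p' * q))) pq' p'q s0
    (geq_minl _ _) (geq_minr _ _).
  rewrite !mupM //; move: (mup a (_ + _)) => m; clear.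
  by move: (mup a p) (mup a p') (mup a q) (mup a q'); lia.
rewrite !ordP1_infty ?mulf_neq0 //.
have := size_polyD (p * q') (p' * q); rewrite !size_mul //.
move: p0 q0 p'0 q'0; rewrite -!size_poly_gt0; move: (size (p * q' + p' * q)%R) => m; clear.
by move: (size p) (size q) (size p') (size q'); lia.
Qed.

Lemma ordP1_cst (x : P1 C) c : c != 0 -> ordP1 x (cst c) = 0.
Proof.
move=> c0; have -> : cst c = (c%:P)%:F / 1%:F by rewrite rmorph1 divr1.
have c0P : c%:P != 0 by rewrite polyC_eq0.
case: x => [a|]; last by rewrite ordP1_infty ?oner_eq0 // size_poly1 size_polyC c0.
by rewrite ordP1_frac ?oner_eq0 // !mupNroot ?rootC ?rootE ?hornerE ?oner_eq0.
Qed.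

Lemma ordP1_trivial (x : P1 C) : trivial_on_constants (ordP1 x).
Proof. by split; [exact: ordP1M|exact: ordP1_cst]. Qed.

Lemma ordP1_XsubC (x : P1 C) z :
  ordP1 x (X - cst z) = if x is Some a then ((a == z) : nat)%:Z else -1.
Proof.
have -> : X - cst z = ('X - z%:P)%:F / 1%:F by rewrite rmorph1 divr1 XsubC_frac.
case: x => [a|].
  rewrite ordP1_frac ?polyXsubC_eq0 ?oner_eq0 // -['X - z%:P]expr1 mup_XsubCX.
  rewrite [mup a 1]mupNroot ?rootE ?hornerE ?oner_eq0 // eq_sym.
  by case: eqP.
by rewrite ordP1_infty ?polyXsubC_eq0 ?oner_eq0 // size_poly1 size_XsubC.
Qed.

Lemma ordP1_discrete (x : P1 C) : discrete_valuation (ordP1 x).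
Proof.
split; [exact: ordP1M|exact: ordP1D|move=> n].
have [t t0 ot] : exists2 t : K, t != 0 & ordP1 x t = 1.
  case: x => [a|].
    by exists (X - cst a); rewrite ?XsubC_frac_neq0 // ordP1_XsubC eqxx.
  exists (1%:F / 'X%:F); last first.
    by rewrite ordP1_infty ?oner_eq0 ?polyX_eq0 // size_polyX size_poly1.
  by rewrite rmorph1 mul1r invr_eq0 tofrac_eq0 polyX_eq0.
have pow m : ordP1 x (t ^+ m) = m%:Z.
  elim: m => [|m IH].
    by rewrite expr0 -(rmorph1 (@cst C)) ordP1_cst ?oner_eq0.
  by rewrite exprS ordP1M ?expf_neq0 // IH ot; lia.
case: n => m; first by exists (t ^+ m); rewrite ?expf_neq0.
exists (t ^+ m.+1)^-1; first by rewrite invr_eq0 expf_neq0.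
have ti0 : (t ^+ m.+1)^-1 != 0 by rewrite invr_eq0 expf_neq0.
have := @ordP1M x _ _ (expf_neq0 m.+1 t0) ti0.
rewrite (divff (expf_neq0 m.+1 t0)) pow -(rmorph1 (@cst C)) ordP1_cst ?oner_eq0 //.
by rewrite NegzE; lia.
Qed.

(** The functions X - a and X - z differ by a constant, of valuation 0, so a nonzero value w(X - a)
    determines all others. A positive value singles out the place a; if there is none, all values
    agree and the place is infinity. *)
Lemma discrete_valuation_classification w : discrete_valuation w ->
  (forall c, c != 0 -> w (cst c) = 0) ->
  exists x, forall g, g != 0 -> w g = ordP1 x g.
Proof.
move=> [wM wD wS] wC.
have triv : trivial_on_constants w by split.
have shift a z : w (X - cst a) != 0 -> a != z -> w (X - cst z) = Num.min (w (X - cst a)) 0.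
  move=> wa az.
  have c0 : a - z != 0 by rewrite subr_eq0.
  have d0 : cst (a - z) != 0 by rewrite fmorph_eq0.
  have e1 : X - cst z = (X - cst a) + cst (a - z) by rewrite rmorphB /= addrA subrK.
  have e2 : X - cst a = (X - cst z) + cst (z - a) by rewrite rmorphB /= addrA subrK.
  have c0' : z - a != 0 by rewrite subr_eq0 eq_sym.
  have d0' : cst (z - a) != 0 by rewrite fmorph_eq0.
  have e3 : cst (a - z) = (X - cst z) + cst (-1) * (X - cst a).
    by rewrite rmorphN1 mulN1r opprB [RHS]addrC subrKA rmorphB.
  have m0 : cst (-1 : C) != 0 by rewrite fmorph_eq0 oppr_eq0 oner_eq0.
  have := wD _ _ (XsubC_frac_neq0 a) d0; rewrite -e1 => /(_ (XsubC_frac_neq0 z)).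
  have := wD _ _ (XsubC_frac_neq0 z) d0'; rewrite -e2 => /(_ (XsubC_frac_neq0 a)).
  have := wD _ _ (XsubC_frac_neq0 z) (mulf_neq0 m0 (XsubC_frac_neq0 a)).
  rewrite -e3 => /(_ d0); rewrite (wM _ _ m0 (XsubC_frac_neq0 a)).
  rewrite !wC ?oppr_eq0 ?oner_eq0 //.
  by move: (w (X - cst z)) (w (X - cst a)) wa; clear; lia.
(* As w takes the value 1, the factor k divides 1. *)
have norm k x : (forall g, g != 0 -> w g = k * ordP1 x g) -> 0 <= k ->
    forall g, g != 0 -> w g = ordP1 x g.
  move=> wk k0; have [t t0 wt] := wS 1; rewrite wk // in wt.
  have k1 : k = 1.
    have /(congr1 absz) : k * ordP1 x t = 1 by [].
    rewrite abszM => /eqP; rewrite muln_eq1 => /andP[/eqP e _].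
    by rewrite -[k]gez0_abs // e.
  by move=> g g0; rewrite wk // k1 mul1r.
have [[a wa]|nowa] := pselect (exists a, 0 < w (X - cst a)).
  exists (Some a); apply: (norm (w (X - cst a))); last exact: ltW.
  apply: (trivial_on_constants_eq triv (trivial_on_constantsZ _ (ordP1_trivial _))) => z.
  rewrite ordP1_XsubC; have [<-|az] := eqVneq a z; first by rewrite mulr1.
  by rewrite (shift a) ?gt_eqF //; move: wa; clear; lia.
have wle z : w (X - cst z) <= 0.
  by rewrite leNgt; apply/negP => wz; apply: nowa; exists z.
exists None; apply: (norm (- w (X - cst 0))); last by rewrite oppr_ge0.
apply: (trivial_on_constants_eq triv (trivial_on_constantsZ _ (ordP1_trivial _))) => z.
rewrite ordP1_XsubC mulrNN mulr1.
have [->//|z0] := eqVneq z 0.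
have [w0|w0] := eqVneq (w (X - cst 0)) 0; last first.
  rewrite (shift 0) // 1?eq_sym //; move: (wle 0); clear; lia.
have [wz|wz] := eqVneq (w (X - cst z)) 0; first by rewrite wz w0.
have := shift z 0 wz z0; rewrite w0; move: (wle z) wz; clear; lia.
Qed.

End Valuations.

(** * Ramification of the Lattes maps *)

Lemma clear_diff (L : fieldType) (A B d F a b n : L) : B != 0 ->
  (d / B ^+ 2) ^+ 2 * F = n * ((A / B) ^+ 3 + a * (A / B) + b) ->
  F * d ^+ 2 = n * B * (A ^+ 3 + a * A * B ^+ 2 + b * B ^+ 3).
Proof.
move=> B0 e; transitivity ((d / B ^+ 2) ^+ 2 * F * B ^+ 4); first by field.
by rewrite e; field.
Qed.

Lemma common_root_mup (C : fieldType) (Q : {poly C}) x : Q != 0 ->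
  root Q x -> root Q^`() x -> (1 < mup x Q)%N.
Proof.
move=> + /factor_theorem[g QE]; rewrite QE derivM derivXsubC mulr1 rootE => Q0.
rewrite !(hornerXsubC, hornerD, hornerM) subrr mulr0 add0r => gx.
have /factor_theorem[h gE] : root g x by [].
by rewrite mup_geq // gE -mulrA -expr2 dvdp_mulIr.
Qed.

Section Ramification.
Variable C : numClosedFieldType.
Variable E : elliptic_curve C.
Local Notation K := (ratfun C).
Local Notation a := (ec_a E).
Local Notation b := (ec_b E).
Local Notation X := ('X%:F : K).
Local Notation F := ((wpoly E)%:F : K).
Local Notation W := (wpoly E).

Lemma root_wpoly x : root W x = (x ^+ 3 + a * x + b == 0).
Proof. by rewrite rootE horner_wpoly. Qed.

Lemma wpoly_roots : exists s : seq C,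
  [/\ uniq s, size s = 3%N & forall x, root W x = (x \in s)].
Proof.
have [s sE] := closed_field_poly_normal W.
have [szW monW] := size_wpoly E; rewrite (monicP monW) scale1r in sE.
exists s; split; last by move=> x; rewrite sE root_prod_XsubC.
  rewrite -separable_prod_XsubC -sE unlock coprimep_def.
  apply/negbNE/negP => /closed_rootP[x]; rewrite root_gcd root_wpoly rootE.
  rewrite deriv_wpoly !(hornerD, hornerM, hornerC, horner_exp, hornerX).
  move=> /andP[/eqP e1 /eqP e2]; move/eqP: (ec_smooth E); apply.
  (* A double root x forces a = -3 x^2 and b = 2 x^3, for which the discriminant vanishes. *)
  have aE : a = - (3%:R * x ^+ 2) by apply/eqP; rewrite -addr_eq0 addrC e2.
  have bE : b = 2%:R * x ^+ 3.
    have -> : b = (x ^+ 3 + a * x + b) - x ^+ 3 - a * x by ring.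
    by rewrite e1 aE; ring.
  by rewrite aE bE; ring.
by have := szW; rewrite sE size_prod_XsubC => -[].
Qed.

Section Pullback.
Variables (n : nat) (i : {rmorphism K -> K}).
Hypothesis n0 : (0 < n)%N.
Hypothesis iP : is_pullback (lattes E n) i.

Lemma pullback_shape : exists A B : {poly C}, mul_shape n A B /\ i X = A%:F / B%:F.
Proof.
case: n n0 iP => // k _ kP; rewrite (pullback_gen_mul kP); exact: gen_mul_shape.
Qed.

Lemma pullback_diff :
  dfrac (i X) ^+ 2 * F = (n ^ 2)%:R * (i X ^+ 3 + cst a * i X + cst b).
Proof.
case: n n0 iP => // k _ kP; rewrite (pullback_gen_mul kP); exact: gen_mul_diff.
Qed.

Variables A B : {poly C}.
Hypothesis shape : mul_shape n A B.
Hypothesis iX : i X = A%:F / B%:F.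

Lemma shape_neq0 : A != 0 /\ B != 0.
Proof.
case: shape => _ _ szA szB _.
by rewrite -!size_poly_gt0 szA szB expn_gt0 n0.
Qed.

Lemma shape_diff : W * (A^`() * B - A * B^`()) ^+ 2 =
  (n ^ 2)%:R%:P * B * (A ^+ 3 + a%:P * A * B ^+ 2 + b%:P * B ^+ 3).
Proof.
have [A0 B0] := shape_neq0.
have B0F : B%:F != 0 :> K by rewrite tofrac_eq0.
apply/eqP; rewrite -tofrac_eq; apply/eqP.
have := pullback_diff; rewrite iX dfrac_frac // [in (B ^+ 2)%:F]tofracXn.
move/(clear_diff B0F) => e.
rewrite [LHS]tofracM tofracXn e.
by rewrite !(tofracXn, tofracM, tofracD) -!/(cst _) -cst_natr.
Qed.

Lemma size_shape_sub z : size (A - z%:P * B) = (n ^ 2).+1.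
Proof.
case: shape => _ _ szA szB _; rewrite size_polyDl ?szA //.
by rewrite size_polyN mul_polyC ltnS (leq_trans (size_scale_leq _ _)) // szB.
Qed.

Lemma shape_sub_neq0 z : A - z%:P * B != 0.
Proof. by rewrite -size_poly_gt0 size_shape_sub. Qed.

Lemma iX_sub z : i (X - cst z) = (A - z%:P * B)%:F / B%:F.
Proof.
have B0F : B%:F != 0 :> K by rewrite tofrac_eq0; case: shape_neq0.
rewrite rmorphB /= (pullback_cst iP) iX tofracB tofracM mulrBl mulfK //.
Qed.

(* Otherwise [Q] would divide [W], which has degree 3. *)
Lemma non_separable (Q R S : {poly C}) : (4 < size Q)%N -> coprimep Q R ->
  W * (Q^`() * R - Q * R^`()) ^+ 2 = Q * S -> exists2 x, root Q x & (1 < mup x Q)%N.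
Proof.
move=> szQ cQR e.
have Q0 : Q != 0 by rewrite -size_poly_gt0 (leq_trans _ szQ).
have [cQQ'|] := boolP (coprimep Q Q^`()); last first.
  rewrite coprimep_def => /closed_rootP[x]; rewrite root_gcd => /andP[Qx Q'x].
  by exists x => //; apply: common_root_mup.
have : Q %| W * (Q^`() * R) ^+ 2.
  have -> : W * (Q^`() * R) ^+ 2 = Q * S + Q * (W * R^`() * (2%:R * (Q^`() * R) - Q * R^`())).
    by rewrite -e; ring.
  by rewrite -mulrDr dvdp_mulIl.
rewrite Gauss_dvdpl; last by rewrite coprimep_expr // coprimepMr cQQ'.
have [szW _] := size_wpoly E.
by move/(dvdp_leq (wpoly_neq0 E)); rewrite szW leqNgt szQ.
Qed.

Lemma ramified_lies_over x (y : C) e : (0 < e)%N ->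
  (forall z, ordP1 (Some y) (i (X - cst z)) = e%:Z * ordP1 x (X - cst z)) ->
  lies_over i (ordP1 x) (ordP1 (Some y)) e.
Proof.
move=> e0 H; split=> //; first exact: ordP1_discrete.
apply: (trivial_on_constants_eq _ (trivial_on_constantsZ e%:Z (ordP1_trivial x)) H).
have inz g : g != 0 -> i g != 0 by rewrite fmorph_eq0.
split=> [g h g0 h0|c c0]; first by rewrite rmorphM (ordP1M _ (inz _ g0) (inz _ h0)).
by rewrite (pullback_cst iP) (ordP1_cst _ c0).
Qed.

Lemma root_ramified x : (2 < n)%N ->
  (if x is Some z then root W z else true) -> ramified_over i x.
Proof.
move=> n2 Wx; have [A0 B0] := shape_neq0.
(* Here n > 2 makes deg B = n^2 - 1 exceed deg W = 3. For n = 2 the denominator is 4 W, which has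
   only simple roots. *)
have n9 : (8 < n ^ 2)%N by rewrite (@leq_trans (3 ^ 2)) // leq_exp2r.
case: shape => cAB monA szA szB lB.
case: x Wx => [z|] Wz.
  set Q := A - z%:P * B.
  have Q0 : Q != 0 by exact: shape_sub_neq0.
  have cQB : coprimep Q B.
    by rewrite coprimep_sym /Q -mulNr addrC coprimep_addl_mul coprimep_sym.
  (* As z is a root of W, the form A^3 + a A B^2 + b B^3 is divisible by A - z B; the last factor is
     the quotient. *)
  have [| | |y Qy my] := @non_separable Q B
    ((n ^ 2)%:R%:P * B * (A ^+ 2 + z%:P * A * B + (z ^+ 2 + a)%:P * B ^+ 2)).
  - by rewrite size_shape_sub; lia.
  - exact: cQB.
  - have -> : Q^`() * B - Q * B^`() = A^`() * B - A * B^`().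
      by rewrite /Q derivB derivM derivC; ring.
    rewrite shape_diff /Q polyCD polyC_exp.
    have -> : b%:P = - (z%:P ^+ 3 + a%:P * z%:P).
      by apply/eqP; rewrite -addr_eq0 addrC -polyC_exp -polyCM -!polyCD polyC_eq0 -root_wpoly.
    by ring.
  have By : ~~ root B y.
    by apply: (coprimep_root cQB).
  exists (ordP1 (Some y)), (mup y Q); split=> //.
  apply: ramified_lies_over; first exact: ltnW.
  move=> z'; rewrite iX_sub ordP1_frac ?shape_sub_neq0 // (mupNroot By) ordP1_XsubC subr0.
  have [<-|zz'] := eqVneq z z'; first by rewrite mulr1.
  rewrite mupNroot ?mulr0 // rootE !hornerE.
  have /eqP : root Q y by []. rewrite /Q !hornerE => /eqP; rewrite subr_eq0 => /eqP ->.
  by rewrite -mulrBl mulf_neq0 ?subr_eq0.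
(* Infinity itself is a simple pole of phi, so ramification over infinity is sought at a multiple
   zero of B. *)
have cBA : coprimep B A by rewrite coprimep_sym.
have [| | |y By my] := @non_separable B A
    ((n ^ 2)%:R%:P * (A ^+ 3 + a%:P * A * B ^+ 2 + b%:P * B ^+ 3)).
- by rewrite szB; lia.
- exact: cBA.
- have -> : B^`() * A - B * A^`() = - (A^`() * B - A * B^`()) by ring.
  by rewrite sqrrN shape_diff; ring.
have Ay : ~~ root A y by apply: (coprimep_root cBA).
exists (ordP1 (Some y)), (mup y B); split=> //.
apply: ramified_lies_over; first exact: ltnW.
move=> z; rewrite iX_sub ordP1_frac ?shape_sub_neq0 // ordP1_XsubC.
rewrite mupNroot ?sub0r ?mulrN1 // rootE !hornerE.
by have /eqP -> : B.[y] == 0 := By; rewrite mulr0 subr0.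
Qed.

(** By the classification the valuation is that of a point y. There phi - z vanishes at least
    doubly, so A' B - A B' vanishes at y and [shape_diff] leaves n^2 B(y)^4 W(z) = 0. *)
Lemma ramified_root z : ramified_over i (Some z) -> root W z.
Proof.
move=> [w [e [[wd e0 we] e1]]]; have [A0 B0] := shape_neq0.
have wC c : c != 0 -> w (cst c) = 0.
  move=> c0; have c0' : cst c != 0 by rewrite fmorph_eq0.
  by rewrite -(pullback_cst iP) we // ordP1_cst // mulr0.
have [y wy] := discrete_valuation_classification wd wC.
have iz0 : i (X - cst z) != 0 by rewrite fmorph_eq0 XsubC_frac_neq0.
have := we _ (XsubC_frac_neq0 z); rewrite ordP1_XsubC eqxx mulr1 wy // iX_sub.
case: shape => cAB monA szA szB lB.
(* At infinity (A - z B) / B has order n^2 - (n^2 + 1) = -1, which is not a ramification index. *)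
case: y {wy} => [y|]; last first.
  rewrite ordP1_infty ?shape_sub_neq0 // size_shape_sub szB.
  by move: (n ^ 2)%N; clear; lia.
rewrite ordP1_frac ?shape_sub_neq0 //; set Q := A - z%:P * B => eQ.
have mQ : (1 < mup y Q)%N by move: eQ e1; clear; lia.
have Q0 : Q != 0 by exact: shape_sub_neq0.
have : ('X - y%:P) ^+ 2 %| Q by rewrite -mup_geq.
case/dvdpP => h QE.
have Qy : A.[y] = z * B.[y].
  have : Q.[y] = 0 by rewrite QE hornerM horner_exp hornerXsubC subrr expr0n mulr0.
  by rewrite /Q !hornerE => /eqP; rewrite subr_eq0 => /eqP.
have By : B.[y] != 0.
  apply/eqP => By; apply: (coprimep_root2 cAB _ By); by rewrite Qy By mulr0.
have := congr1 (horner^~ y) shape_diff.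
have -> : A^`() * B - A * B^`() = Q^`() * B - Q * B^`().
  by rewrite /Q derivB derivM derivC; ring.
have Qy0 : Q.[y] = 0 by rewrite QE hornerM horner_exp hornerXsubC subrr expr0n mulr0.
have Q'y : Q^`().[y] = 0.
  by rewrite QE expr2 !derivM derivXsubC !(hornerXsubC, hornerD, hornerM) subrr; ring.
clearbody Q; rewrite !(hornerM, hornerD, horner_exp, hornerN, hornerC) Qy0 Q'y Qy.
rewrite !(mul0r, subr0, mulr0) => /esym e'.
rewrite root_wpoly; apply/eqP.
have n2 : (n ^ 2)%:R != 0 :> C by rewrite pnatr_eq0 -lt0n expn_gt0 n0.
apply: (mulfI (mulf_neq0 n2 (expf_neq0 4 By))).
by rewrite mulr0 -e'; ring.
Qed.

End Pullback.
End Ramification.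

(** * Behaviour at infinity and commutation *)

Lemma asym_add_id (L : fieldType) (x p q r s : L) : q != 0 -> s != 0 ->
  x * (p / q) + x * (r / s) = x * ((p * s + r * q) / (q * s)).
Proof. by move=> q0 s0; field; rewrite q0 s0. Qed.

Lemma asym_mul_id (L : fieldType) (x y p q r s : L) :
  x * (p / q) * (y * (r / s)) = x * y * (p * r / (q * s)).
Proof. by rewrite mulrACA mulf_div. Qed.

Lemma asym_weaken_id (L : fieldType) (x y z p q : L) : y * z = 1 ->
  x * (p / q) = x * y * (p * z / q).
Proof. by move=> yz; rewrite -[in LHS](mul1r p) -yz; ring. Qed.

Lemma asym_deriv_id (L : fieldType) (x k p q dp dq t : L) : q != 0 ->
  k * x * t * (p / q) + x * ((- t ^+ 2 * dp * q - p * (- t ^+ 2 * dq)) / q ^+ 2) =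
  x * t * ((k * p * q - t * (dp * q - p * dq)) / q ^+ 2).
Proof. by move=> q0; field. Qed.

Section Infinity.
Variable C : numClosedFieldType.
Local Notation K := (ratfun C).
Local Notation X := ('X%:F : K).
Implicit Types (p q : {poly C}) (g h : K) (k l : int) (c d : C).

(** This is p(1 / X), a polynomial in the local parameter at infinity. *)
Definition subst_inv p : K := (map_poly (@cst C) p).[X^-1].

Fact subst_inv_is_zmod_morphism : zmod_morphism subst_inv.
Proof. by move=> p q; rewrite /subst_inv rmorphB hornerD hornerN. Qed.
HB.instance Definition _ := GRing.isZmodMorphism.Build {poly C} K subst_inv
  subst_inv_is_zmod_morphism.

Fact subst_inv_is_monoid_morphism : monoid_morphism subst_inv.
Proof. by split=> [|p q]; rewrite /subst_inv ?rmorph1 ?hornerC // rmorphM hornerM. Qed.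
HB.instance Definition _ := GRing.isMonoidMorphism.Build {poly C} K subst_inv
  subst_inv_is_monoid_morphism.

Lemma subst_invC c : subst_inv c%:P = cst c.
Proof. by rewrite /subst_inv map_polyC hornerC. Qed.

Lemma subst_invX : subst_inv 'X = X^-1.
Proof. by rewrite /subst_inv map_polyX hornerX. Qed.

Lemma X_neq0 : X != 0.
Proof. by rewrite tofrac_eq0 polyX_eq0. Qed.

Lemma subst_inv_eq0 p : (subst_inv p == 0) = (p == 0).
Proof.
apply/idP/eqP => [|->]; last by rewrite rmorph0.
apply: contraTeq => p0; have [s pE] := closed_field_poly_normal p.
have l0 : subst_inv (lead_coef p)%:P != 0.
  by rewrite subst_invC fmorph_eq0 lead_coef_eq0.
rewrite [in subst_inv p]pE -mul_polyC (rmorphM subst_inv); apply: (mulf_neq0 l0).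
rewrite rmorph_prod prodf_seq_neq0; apply/allP => z _ /=.
rewrite rmorphB /= subst_invX subst_invC subr_eq0; apply/eqP => e.
have := evalP1_cst z (Some 0); rewrite -e -[X^-1]mul1r -tofrac1.
by rewrite evalP1_coprime ?polyX_eq0 ?coprime1p // rootX eqxx.
Qed.

Lemma subst_inv_inj : injective subst_inv.
Proof.
by move=> p q /eqP; rewrite -subr_eq0 -rmorphB subst_inv_eq0 subr_eq0 => /eqP.
Qed.

Lemma dfrac_Xinv : dfrac X^-1 = - X^-1 ^+ 2.
Proof.
rewrite -[in LHS](mul1r X^-1) (dfrac_div _ X_neq0) -(rmorph1 (@cst C)) dfrac_cst dfrac_X.
by rewrite mul0r sub0r rmorph1 mulr1 mulN1r exprVn.
Qed.

Lemma dfrac_subst_inv p : dfrac (subst_inv p) = - X^-1 ^+ 2 * subst_inv p^`().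
Proof.
elim/poly_ind: p => [|p c IH].
  by rewrite deriv0 !rmorph0 mulr0 -(rmorph0 (@cst C)) dfrac_cst.
rewrite derivD derivM derivX derivC addr0 mulr1 !rmorphD !rmorphM /=.
rewrite !subst_invX subst_invC dfracD dfrac_cst addr0 dfracM IH dfrac_Xinv.
by rewrite [RHS]mulrDr mulrA [subst_inv p * _]mulrC.
Qed.

Lemma dfrac_exprz k : dfrac (X ^ k) = k%:~R * X ^ k * X^-1.
Proof.
have nat n : dfrac (X ^+ n) = n%:R * X ^+ n * X^-1.
  case: n => [|n]; first by rewrite expr0 mul0r mul0r -(rmorph1 (@cst C)) dfrac_cst.
  by rewrite dfracXn dfrac_X mulr1 exprSr mulrA (mulfK X_neq0).
case: k => n; first exact: nat.
have X0 := expf_neq0 n.+1 X_neq0.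
rewrite NegzE -exprnN -[in LHS](mul1r (X ^- n.+1)) (dfrac_div _ X0).
rewrite -{1}(rmorph1 (@cst C)) dfrac_cst nat mul0r sub0r mul1r mulrNz mulNr !mulNr; congr (- _).
by rewrite expr2 invfM mulrA mulrAC [X in X / _]mulrAC (mulfK X0) mulrAC.
Qed.

(* [asym g k c]: g = c X^k + O(X^(k-1)) at infinity, where c may be zero. *)
Definition asym g k c := exists p q,
  [/\ q.[0] != 0, g = X ^ k * (subst_inv p / subst_inv q) & c = p.[0] / q.[0]].

Lemma horner_neq0 q (x : C) : q.[x] != 0 -> q != 0.
Proof. by apply: contraNneq => ->; rewrite horner0. Qed.

Lemma subst_inv_neq0 q : q.[0] != 0 -> subst_inv q != 0.
Proof. by rewrite subst_inv_eq0; exact: horner_neq0. Qed.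

Lemma asymM g h k l c d : asym g k c -> asym h l d -> asym (g * h) (k + l) (c * d).
Proof.
move=> [p [q [q0 -> ->]]] [r [s [s0 -> ->]]]; exists (p * r), (q * s); split.
- by rewrite hornerM mulf_neq0.
- by rewrite (expfzDr _ _ X_neq0) asym_mul_id !rmorphM.
- by rewrite !hornerM mulf_div.
Qed.

Lemma asymD g h k c d : asym g k c -> asym h k d -> asym (g + h) k (c + d).
Proof.
move=> [p [q [q0 -> ->]]] [r [s [s0 -> ->]]].
exists (p * s + r * q), (q * s); split.
- by rewrite hornerM mulf_neq0.
- rewrite (asym_add_id _ _ _ (subst_inv_neq0 q0) (subst_inv_neq0 s0)).
  by rewrite rmorphD !rmorphM.
- by rewrite hornerD !hornerM addf_div.
Qed.

Lemma asym_cst c : asym (cst c) 0 c.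
Proof.
exists c%:P, 1; rewrite !hornerC oner_eq0 divr1; split=> //.
by rewrite expr0z mul1r rmorph1 divr1 subst_invC.
Qed.

Lemma asymX k : asym (X ^ k) k 1.
Proof. by exists 1, 1; rewrite !hornerC oner_eq0 divr1 rmorph1 divr1 mulr1. Qed.

Lemma asym_unique g k c d : asym g k c -> asym g k d -> c = d.
Proof.
move=> [p [q [q0 -> ->]]] [r [s [s0 e ->]]].
have Xk : X ^ k != 0 := expfz_neq0 k X_neq0.
move/(mulfI Xk)/eqP: e; rewrite (eqr_div _ _ (subst_inv_neq0 q0) (subst_inv_neq0 s0)).
rewrite -!rmorphM => /eqP/subst_inv_inj e.
by apply/eqP; rewrite eqr_div // -!hornerM e.
Qed.

Lemma asym_weaken g k l c : k < l -> asym g k c -> asym g l 0.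
Proof.
move=> kl [p [q [q0 -> _]]].
have lE : l = k + (absz (l - k - 1)%R).+1 by lia.
move: (absz _) lE => m lE.
exists (p * 'X ^+ m.+1), q; split=> //; last first.
  by rewrite hornerM hornerXn expr0n mulr0 mul0r.
rewrite lE (expfzDr _ _ X_neq0) rmorphM rmorphXn /= subst_invX.
by apply: asym_weaken_id; rewrite -exprMn (divff X_neq0) expr1n.
Qed.

(** With t = 1 / X one has t' = -t^2, so differentiating the factor p(t) / q(t) only contributes
    O(X^(k-2)). *)
Lemma asym_deriv g k c : asym g k c -> asym (dfrac g) (k - 1) (k%:~R * c).
Proof.
move=> [p [q [q0 -> ->]]].
exists ((k%:~R)%:P * p * q - 'X * (p^`() * q - p * q^`())), (q ^+ 2); split.
- by rewrite horner_exp expf_neq0.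
- have q0' := subst_inv_neq0 q0.
  rewrite dfracM dfrac_exprz (dfrac_div _ q0') !dfrac_subst_inv (asym_deriv_id _ _ _ _ _ _ q0').
  rewrite (expfzDr _ _ X_neq0) -[X ^ (-1)]/(X^-1); congr (_ * (_ / _)); last by rewrite rmorphXn.
  by rewrite !(rmorphB, rmorphM) /= subst_invX subst_invC rmorph_int.
- rewrite !(hornerD, hornerN, hornerM, hornerC, hornerX, horner_exp) mul0r subr0.
  by rewrite -mulf_div (divff q0) mulr1 mulrA.
Qed.

Lemma asym_eq g k c d : asym g k c -> c = d -> asym g k d.
Proof. by move=> ? <-. Qed.

Lemma asym_eqk g k l c : asym g k c -> k = l -> asym g l c.
Proof. by move=> ? <-. Qed.

Lemma asymN g k c : asym g k c -> asym (- g) k (- c).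
Proof.
move/(asymM (asym_cst (-1))); rewrite add0r mulN1r rmorphN1 mulN1r.
exact.
Qed.

Lemma asymB g h k c d : asym g k c -> asym h k d -> asym (g - h) k (c - d).
Proof. by move=> gk /asymN hk; apply: asymD. Qed.

Lemma asymV g k c : c != 0 -> asym g k c -> asym g^-1 (- k) c^-1.
Proof.
move=> c0 [p [q [q0 -> cE]]].
have p0 : p.[0] != 0 by apply: contraNneq c0 => p0; rewrite cE p0 mul0r.
exists q, p; split=> //; first by rewrite invfM invf_div invr_expz.
by rewrite cE invf_div.
Qed.

Lemma asym_poly p : asym p%:F ((size p).-1)%:Z (lead_coef p).
Proof.
have [s pE] := closed_field_poly_normal p.
have [->|p0] := eqVneq p 0.
  by rewrite size_poly0 lead_coef0 rmorph0 -(rmorph0 (@cst C)); exact: asym_cst.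
have -> : (size p).-1 = size s.
  by rewrite pE size_scale ?lead_coef_eq0 // size_prod_XsubC.
have prod : asym (\prod_(z <- s) ('X - z%:P))%:F (size s)%:Z 1.
  elim: s {pE} => [|z s IH].
    by rewrite big_nil rmorph1 -(rmorph1 (@cst C)); exact: asym_cst.
  rewrite big_cons tofracM -XsubC_frac.
  have := asymM (_ : asym (X - cst z) 1 1) IH; rewrite mulr1; apply.
  apply: (asym_eq (asymB (asymX 1) (asym_weaken _ (asym_cst z)))) => //.
  by rewrite subr0.
rewrite [in p%:F]pE -mul_polyC tofracM.
by have := asymM (asym_cst (lead_coef p)) prod; rewrite mulr1 add0r.
Qed.

Lemma asym_frac p q : q != 0 ->
  asym (p%:F / q%:F) ((size p).-1%:Z - (size q).-1%:Z) (lead_coef p / lead_coef q).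
Proof.
move=> q0; apply: asymM (asym_poly p) (asymV _ (asym_poly q)).
by rewrite lead_coef_eq0.
Qed.

Lemma asym_exists g : g != 0 -> exists k c, c != 0 /\ asym g k c.
Proof.
move=> /fracP_neq0[p [q [p0 q0 ->]]].
exists ((size p).-1%:Z - (size q).-1%:Z), (lead_coef p / lead_coef q).
by rewrite mulf_neq0 ?invr_eq0 ?lead_coef_eq0 //; split=> //; exact: asym_frac.
Qed.

Lemma asym_pole g : evalP1 g None = None -> exists k c, [/\ 0 < k, c != 0 & asym g k c].
Proof.
move=> /=; case: ifP => // sz _.
have d0 := denom_neq0 g.
have n0 : numer g != 0 by rewrite -size_poly_gt0 (leq_trans _ sz).
exists ((size (numer g)).-1%:Z - (size (denom g)).-1%:Z).
exists (lead_coef (numer g) / lead_coef (denom g)).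
split; last by rewrite {1}(numer_denomE g); apply: asym_frac.
  move: d0 sz; rewrite -size_poly_gt0; move: (size _) (size _); lia.
by rewrite mulf_neq0 ?invr_eq0 ?lead_coef_eq0.
Qed.

End Infinity.

(** * Uniqueness for the differential equation *)

Lemma diff_eq_sub (L : fieldType) (d1 d2 F n w1 w2 a b : L) :
  d1 ^+ 2 * F = n * (w1 ^+ 3 + a * w1 + b) ->
  d2 ^+ 2 * F = n * (w2 ^+ 3 + a * w2 + b) ->
  (d1 - d2) * (d1 + d2) * F = n * ((w1 - w2) * (w1 * w1 + w1 * w2 + w2 * w2 + a)).
Proof.
move=> e1 e2; transitivity (d1 ^+ 2 * F - d2 ^+ 2 * F); first by ring.
by rewrite e1 e2; ring.
Qed.

Section Uniqueness.
Variable C : numClosedFieldType.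
Variable E : elliptic_curve C.
Local Notation K := (ratfun C).
Local Notation X := ('X%:F : K).
Local Notation F := ((wpoly E)%:F : K).

Definition mul_diff_eq n (w : K) := dfrac w ^+ 2 * F =
  (n ^ 2)%:R * (w ^+ 3 + cst (ec_a E) * w + cst (ec_b E)).

Lemma asymF : asym F 3 1.
Proof.
by have := asym_poly (wpoly E); have [-> /monicP ->] := size_wpoly E.
Qed.

Lemma asym_natr n : asym (n%:R : K) 0 n%:R.
Proof. by rewrite cst_natr; exact: asym_cst. Qed.

(** For a pole of order k the two sides have orders 2(k - 1) + 3 and 3k, which forces k = 1; the
    leading coefficients then give c^2 = n^2 c^3. *)
Lemma mul_diff_eq_infty n w : (0 < n)%N -> mul_diff_eq n w -> evalP1 w None = None ->
  exists2 c, (n ^ 2)%:R * c = 1 & asym w 1 c.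
Proof.
move=> n0 de /asym_pole[k [c [k0 c0 wk]]].
have wd := asym_deriv wk.
have lhs := asymM (asymM wd wd) asymF; rewrite -expr2 de in lhs.
have w3 := asymM (asymM wk wk) wk.
have aw : asym (cst (ec_a E) * w) (k + k + k) 0.
  by apply: (asym_weaken _ (asymM (asym_cst _) wk)); lia.
have bw : asym (cst (ec_b E)) (k + k + k) 0.
  by apply: (asym_weaken _ (asym_cst _)); lia.
have := asymM (asym_natr (n ^ 2)) (asymD (asymD w3 aw) bw).
rewrite !addr0 add0r -expr2 -exprSr => rhs.
have [k1|k1] := eqVneq k 1.
  rewrite k1 in lhs rhs wk; exists c => //.
  have := asym_unique lhs rhs; rewrite !mul1r mulr1 => e.
  by apply: (mulfI (mulf_neq0 c0 c0)); rewrite mulr1 {2}e; ring.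
have lt : k - 1 + (k - 1) + 3 < k + k + k by lia.
have := asym_unique (asym_weaken lt lhs) rhs.
move/esym/eqP; rewrite !mulf_eq0 (negPf c0) !orbF pnatr_eq0 expn_eq0.
by rewrite gtn_eqF.
Qed.

(* The difference of two solutions satisfies a linear equation whose exponent [j] at
   infinity would have to be 3/2. *)
Lemma mul_diff_eq_unique n w1 w2 : (0 < n)%N ->
  mul_diff_eq n w1 -> mul_diff_eq n w2 ->
  evalP1 w1 None = None -> evalP1 w2 None = None -> w1 = w2.
Proof.
move=> n0 de1 de2 p1 p2.
have [c nc a1] := mul_diff_eq_infty n0 de1 p1.
have [c' nc' a2] := mul_diff_eq_infty n0 de2 p2.
have nn0 : (n ^ 2)%:R != 0 :> C by rewrite pnatr_eq0 expn_eq0 gtn_eqF.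
have cc' : c' = c by apply: (mulfI nn0); rewrite nc nc'.
rewrite {}cc' {nc'} in a2.
have c0 : c != 0.
  by apply/eqP => c0; move/eqP: nc; rewrite c0 mulr0 eq_sym oner_eq0.
apply/eqP; rewrite -subr_eq0; apply: contraT => /asym_exists[j [d [d0 wd]]].
have key := diff_eq_sub de1 de2.
have dwd := asym_deriv wd; rewrite dfracB in dwd.
have lhs := asymM (asymM dwd (asymD (asym_deriv a1) (asym_deriv a2))) asymF.
have aw : asym (cst (ec_a E)) (1 + 1) 0 by apply: (asym_weaken _ (asym_cst _)).
have rhs := asymM (asym_natr (n ^ 2)) (asymM wd
  (asymD (asymD (asymD (asymM a1 a1) (asymM a1 a2)) (asymM a2 a2)) aw)).
rewrite key in lhs; have ek : 0 + (j + (1 + 1)) = j - 1 + (1 - 1) + 3 by lia.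
have := asym_unique lhs (asym_eqk rhs ek).
rewrite mul1r mulr1 => e.
(* The coefficients of X^(j+2) are 2 j d c on the left and 3 n^2 d c^2 on the right, and n^2 c =
   1. *)
have : 2%:R * j%:~R = 3%:R :> C.
  apply: (mulfI (mulf_neq0 d0 c0)).
  transitivity (j%:~R * d * (c + c)); first by ring.
  rewrite e; transitivity (((n ^ 2)%:R * c) * (3%:R * (d * c))); first by ring.
  by rewrite nc; ring.
have -> : 2%:R * j%:~R = (2 * j)%:~R :> C by rewrite intrM.
by rewrite -[3%:R]/(3%:~R) => /eqP; rewrite eqr_int => /eqP; lia.
Qed.

Lemma lattes_infty n : lattes E n None = None.
Proof.
have mul0 P : pt P = None -> pt (ec_mul n P) = None :> option (C * C).
  by move=> PE; elim: n => // m IH; rewrite ec_mulS /= IH PE.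
by rewrite /lattes /ec_pi mul0.
Qed.

Lemma rmorph_frac_ext (i j : {rmorphism K -> K}) :
  (forall c, i (cst c) = cst c) -> (forall c, j (cst c) = cst c) ->
  i X = j X -> i =1 j.
Proof.
move=> iC jC ij g; have [p [q [q0 ->]]] := fracP g.
rewrite [LHS]fmorph_div [RHS]fmorph_div.
rewrite (rmorph_frac_poly iC p) (rmorph_frac_poly iC q).
by rewrite (rmorph_frac_poly jC p) (rmorph_frac_poly jC q) ij.
Qed.

Lemma rmorph_cubic (i : {rmorphism K -> K}) a b g : (forall c, i (cst c) = cst c) ->
  i (g ^+ 3 + cst a * g + cst b) = i g ^+ 3 + cst a * i g + cst b.
Proof. by move=> iC; rewrite !(rmorphD i) (rmorphXn i) (rmorphM i) !iC. Qed.

(** The image of X is phi_m o phi_l. By the chain rule the square of its derivative times F is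
    (phi_m'^2 o phi_l) times l^2 F(phi_l), that is, l^2 times the pullback under phi_l of phi_m'^2 F
    = m^2 f(phi_m). *)
Lemma pullback_comp l m (iL iM iLM : {rmorphism K -> K}) : (0 < l)%N -> (0 < m)%N ->
  is_pullback (lattes E l) iL -> is_pullback (lattes E m) iM ->
  is_pullback (lattes E (l * m)) iLM -> iL \o iM =1 iLM.
Proof.
move=> l0 m0 Lp Mp LMp.
have Lc := pullback_cst Lp; have Mc := pullback_cst Mp; have LMc := pullback_cst LMp.
apply: (@rmorph_frac_ext (iL \o iM) iLM) => [c|//|] /=; first by rewrite Mc Lc.
apply: (@mul_diff_eq_unique (l * m)).
- by rewrite muln_gt0 l0.
- have dL := pullback_diff l0 Lp; have dM := pullback_diff m0 Mp.
  rewrite /mul_diff_eq (dfrac_rmorph Lc) exprMn -mulrA dL.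
  rewrite -(rmorph_cubic _ _ _ Lc) -wpolyE mulrCA -(rmorphXn iL) -(rmorphM iL) dM.
  by rewrite (rmorphM iL) (rmorph_cubic _ _ _ Lc) rmorph_nat mulrA expnMn natrM.
- by apply: pullback_diff LMp; rewrite muln_gt0 l0.
- by rewrite Lp lattes_infty (evalP1_pullback_X Mp) lattes_infty.
- by rewrite (evalP1_pullback_X LMp) lattes_infty.
Qed.

End Uniqueness.

(** * Bases and composita *)

Lemma homogenize_id (L : fieldType) (x y c : L) k M : y != 0 -> (k <= M)%N ->
  y ^+ M * (c * (x / y) ^+ k) = x ^+ k * y ^+ (M - k) * c.
Proof.
move=> y0 kM; rewrite expr_div_n -[in y ^+ M](subnK kM) exprD.
have := expf_neq0 k y0; move: (y ^+ k) => w w0.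
by move: (y ^+ (M - k)) (x ^+ k) => z u; field.
Qed.

Section Families.
Variables (k L : fieldType) (i : {rmorphism k -> L}) (N : nat).
Implicit Types b c : 'I_N -> L.

Definition independent c :=
  forall x : 'I_N -> k, \sum_j i (x j) * c j = 0 -> forall j, x j = 0.

Definition in_span b (g : L) := exists x : 'I_N -> k, g = \sum_j i (x j) * b j.

Lemma in_spanD b g h : in_span b g -> in_span b h -> in_span b (g + h).
Proof.
move=> [x ->] [y ->]; exists (fun j => x j + y j); rewrite -big_split.
by apply: eq_bigr => j _; rewrite rmorphD mulrDl.
Qed.

Lemma in_spanZ b a g : in_span b g -> in_span b (i a * g).
Proof.
move=> [x ->]; exists (fun j => a * x j); rewrite mulr_sumr.
by apply: eq_bigr => j _; rewrite rmorphM mulrA.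
Qed.

Lemma in_span0 b : in_span b 0.
Proof.
by exists (fun=> 0); rewrite big1 // => j _; rewrite rmorph0 mul0r.
Qed.

Lemma in_span_sum b (I : Type) (r : seq I) (P : pred I) (g : I -> L) :
  (forall j, P j -> in_span b (g j)) -> in_span b (\sum_(j <- r | P j) g j).
Proof.
by move=> H; apply: big_ind => //; [exact: in_span0|exact: in_spanD].
Qed.

Lemma in_span_gen b j : in_span b (b j).
Proof.
exists (fun l => (l == j)%:R); rewrite (bigD1 j) //= eqxx rmorph1 mul1r big1 ?addr0 //.
by move=> l /negPf ->; rewrite rmorph0 mul0r.
Qed.

(** The square matrix that expresses c through b has trivial left kernel, hence is invertible. *)
Lemma independent_exchange b c : independent c ->
  (forall j, in_span b (c j)) -> forall j, in_span c (b j).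
Proof.
move=> ind /choice[m mE]; pose M : 'M[k]_N := \matrix_(j, l) m j l.
have cE j : c j = \sum_l i (M j l) * b l.
  by rewrite mE; apply: eq_bigr => l _; rewrite mxE.
have comb (v : 'rV[k]_N) : \sum_j i (v 0 j) * c j = \sum_l i ((v *m M) 0 l) * b l.
  under eq_bigr => j _ do rewrite cE mulr_sumr.
  rewrite exchange_big; apply: eq_bigr => l _.
  rewrite mxE rmorph_sum mulr_suml; apply: eq_bigr => j _.
  by rewrite rmorphM mulrA.
have free : row_free M.
  apply: inj_row_free => v vM; apply/rowP => j; rewrite mxE.
  apply: ind; rewrite comb vM big1 // => l _.
  by rewrite mxE rmorph0 mul0r.
move=> j; exists (fun l => invmx M j l).
have := comb (row j (invmx M)); rewrite -row_mul mulVmx -?row_free_unit // => e.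
transitivity (\sum_l i ((row j 1%:M : 'rV[k]_N) 0 l) * b l).
  rewrite (bigD1 j) //= big1 ?addr0 => [|l lj]; rewrite !mxE ?eqxx ?rmorph1 ?mul1r //.
  by rewrite eq_sym (negPf lj) rmorph0 mul0r.
by rewrite -e; apply: eq_bigr => l _; rewrite mxE.
Qed.

End Families.

Section Basis.
Variable C : numClosedFieldType.
Local Notation K := (ratfun C).
Local Notation X := ('X%:F : K).
Variables (i : {rmorphism K -> K}) (A B : {poly C}) (N : nat).
Hypothesis iC : forall c, i (cst c) = cst c.
Hypothesis iX : i X = A%:F / B%:F.
Hypothesis cAB : coprimep A B.
Hypothesis monA : A \is monic.
Hypothesis szA : size A = N.+1.
Hypothesis szB : (size B <= N)%N.
Hypothesis B0 : B != 0.

(* Reducing modulo [A], of degree [N], kills the coefficients [D k] one by one. *)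
Lemma homogeneous_relation M (D : nat -> {poly C}) :
  (forall k, (size (D k) <= N)%N) ->
  \sum_(k < M.+1) A ^+ k * B ^+ (M - k) * D k = 0 ->
  forall k, (k <= M)%N -> D k = 0.
Proof.
elim: M D => [|M IH] D szD.
  rewrite big_ord1 expr0 mul1r expr0 mul1r => D0 k.
  by rewrite leqn0 => /eqP ->.
rewrite big_ord_recl expr0 mul1r subn0 => e.
have e2 : \sum_(k < M.+1) A ^+ (bump 0 k) * B ^+ (M.+1 - bump 0 k) * D (bump 0 k) =
    A * \sum_(k < M.+1) A ^+ k * B ^+ (M - k) * D k.+1.
  rewrite mulr_sumr; apply: eq_bigr => k _.
  by rewrite /bump leq0n add1n subSS exprS !mulrA.
rewrite e2 in e; set S := \sum_(k < M.+1) _ in e.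
have D0 : D 0%N = 0.
  apply/eqP; apply: contraT => D0.
  have : A %| B ^+ M.+1 * D 0%N.
    by rewrite -(dvdp_addl _ (dvdp_mulIl A S)) e dvdp0.
  rewrite Gauss_dvdpr ?coprimep_expr // => /(dvdp_leq D0).
  by rewrite szA leqNgt ltnS szD.
move: e; rewrite D0 mulr0 add0r => /eqP; rewrite mulf_eq0 (negPf (monic_neq0 monA)) /=.
move/eqP => /(IH (fun k => D k.+1) (fun k => szD _)) H [|k] // kM.
exact: H.
Qed.

Definition Xpow (j : 'I_N) : K := X ^+ j.

Lemma i_poly_expand (p : {poly C}) M : (size p <= M.+1)%N ->
  (B ^+ M)%:F * i p%:F = (\sum_(k < M.+1) A ^+ k * B ^+ (M - k) * (p`_k)%:P)%:F.
Proof.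
move=> szp; rewrite (rmorph_frac_poly iC) iX.
have B0F : B%:F != 0 :> K by rewrite tofrac_eq0.
rewrite (horner_coef_wide _ (leq_trans (size_poly _ _) szp)) mulr_sumr rmorph_sum.
apply: eq_bigr => k _; rewrite coef_map /= !tofracM -/(cst _) !tofracXn.
by apply: homogenize_id => //; rewrite -ltnS.
Qed.

Lemma common_denominator (c : 'I_N -> K) : exists2 q : {poly C}, q != 0 &
  exists p : 'I_N -> {poly C}, forall j, c j = (p j)%:F / q%:F.
Proof.
exists (\prod_j denom (c j)).
  by apply/prodf_neq0 => j _; exact: denom_neq0.
exists (fun j => numer (c j) * \prod_(l | l != j) denom (c l)) => j.
have -> : \prod_l denom (c l) = denom (c j) * \prod_(l | l != j) denom (c l).
  by rewrite (bigD1 j).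
rewrite frac_common; first exact: numer_denomE.
by apply/prodf_neq0 => l _; exact: denom_neq0.
Qed.

Lemma Xpow_independent : independent i Xpow.
Proof.
move=> c c0; have [q q0 [p cE]] := common_denominator c.
have q0F : q%:F != 0 :> K by rewrite tofrac_eq0.
have iq0 : i q%:F != 0 by rewrite fmorph_eq0.
have rel : \sum_j i (p j)%:F * Xpow j = 0.
  apply: (mulIf (etrans (congr1 negb (invr_eq0 _)) iq0)); rewrite mul0r -[RHS]c0 mulr_suml.
  by apply: eq_bigr => j _; rewrite cE fmorph_div mulrAC.
pose M := (\max_j size (p j))%N.
have szp j : (size (p j) <= M.+1)%N by rewrite leqW // leq_bigmax.
(* Exchanging sums turns sum_j p_j(phi) X^j into sum_k phi^k D_k(X), with every D_k of degree less
   than N; B^M clears the denominators. *)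
pose D k := \poly_(j < N) (if insub j is Some j' then (p j')`_k else 0).
have DE k : D k = \sum_(j < N) ((p j)`_k)%:P * 'X^j.
  rewrite /D poly_def; apply: eq_bigr => j _.
  by rewrite insubT // => lt; rewrite mul_polyC; congr (_ *: _); congr (p _)`_k; exact: val_inj.
have DM : \sum_(k < M.+1) A ^+ k * B ^+ (M - k) * D k = 0.
  apply/eqP; rewrite -tofrac_eq0; apply/eqP.
  transitivity ((B ^+ M)%:F * \sum_j i (p j)%:F * Xpow j); last by rewrite rel mulr0.
  rewrite mulr_sumr; under [RHS]eq_bigr => j _ do
    rewrite mulrA (i_poly_expand (szp j)) /Xpow -tofracXn -tofracM mulr_suml.
  rewrite -rmorph_sum exchange_big; congr (_%:F); apply: eq_bigr => k _.
  by rewrite DE mulr_sumr; apply: eq_bigr => j _; rewrite mulrA.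
have szD k : (size (D k) <= N)%N by exact: size_poly.
have H := homogeneous_relation szD DM.
move=> j; rewrite cE; suff -> : p j = 0 by rewrite rmorph0 mul0r.
apply/polyP => k; rewrite coef0; have [kM|Mk] := leqP k M; last first.
  by rewrite nth_default // (leq_trans (szp j)).
have := congr1 (fun r : {poly C} => r`_j) (H k kM).
rewrite /= coef_poly ltn_ord coef0 insubT // => lt e.
by rewrite -[RHS]e; congr (p _)`_k; exact: val_inj.
Qed.

Lemma Xpow_span_poly (p : {poly C}) : in_span i Xpow p%:F.
Proof.
have N0 : (0 < N)%N by apply: leq_trans szB; rewrite size_poly_gt0.
have low (r : {poly C}) : (size r <= N)%N -> in_span i Xpow r%:F.
  move=> szr; exists (fun j => cst r`_j).
  rewrite -[r in LHS]coefK poly_def rmorph_sum.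
  rewrite (big_ord_widen _ (fun j => (r`_j *: 'X^j)%:F) szr).
  rewrite big_mkcond; apply: eq_bigr => j _; rewrite iC -mul_polyC tofracM tofracXn -/(cst _).
  by case: ltnP => // h; rewrite nth_default // rmorph0 mul0r.
have B0F : B%:F != 0 :> K by rewrite tofrac_eq0.
(* A is monic of degree N, so in X^N = phi B + (X^N - A) both B and X^N - A have degree less than
   N. *)
have XN : in_span i Xpow (X ^+ N).
  have -> : X ^+ N = i X * B%:F + ('X^N - A)%:F.
    by rewrite iX divfK // tofracB tofracXn addrC subrK.
  apply: in_spanD; first exact/in_spanZ/low.
  apply: low; apply/leq_sizeP => j; rewrite leq_eqVlt => /orP[/eqP <-|Nj].
    by rewrite coefB coefXn eqxx -[N]/(N.+1.-1) -szA -/(lead_coef A) (monicP monA) subrr.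
  by rewrite coefB coefXn gtn_eqF // [A`_j]nth_default ?subrr // szA.
have mulX g : in_span i Xpow g -> in_span i Xpow (g * X).
  move=> [x ->]; rewrite mulr_suml; apply: in_span_sum => j _.
  rewrite -mulrA; apply: in_spanZ; rewrite /Xpow -exprSr.
  have := ltn_ord j; rewrite leq_eqVlt => /orP[/eqP -> //|jN].
  exact: (in_span_gen i Xpow (Ordinal jN)).
elim/poly_ind: p => [|p c IH]; first by rewrite rmorph0; exact: in_span0.
rewrite rmorphD rmorphM; apply: in_spanD; first exact: mulX.
by apply: low; apply: leq_trans (size_polyC_leq1 _) N0.
Qed.

(** The q X^j are N independent elements of the span of the X^l. By exchange every X^j is a
    combination of the q X^l; dividing by q puts X^j / q in the span. *)
Lemma Xpow_span g : in_span i Xpow g.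
Proof.
have [p [q [q0 ->]]] := fracP g.
have q0F : q%:F != 0 :> K by rewrite tofrac_eq0.
have ind : independent i (fun j => q%:F * Xpow j).
  move=> x; under eq_bigr => j _ do rewrite mulrCA.
  rewrite -mulr_sumr => /eqP; rewrite mulf_eq0 (negPf q0F) /= => /eqP.
  exact: Xpow_independent.
have ex := independent_exchange ind (fun j => _ : in_span i Xpow (q%:F * Xpow j)).
have [x pE] := Xpow_span_poly p.
rewrite pE mulr_suml; apply: in_span_sum => j _; rewrite -mulrA; apply: in_spanZ.
have [|y ->] := ex _ j.
  by move=> l; rewrite /Xpow -tofracXn -tofracM; exact: Xpow_span_poly.
exists y; rewrite mulr_suml; apply: eq_bigr => l _.
by rewrite -mulrA; congr (_ * _); rewrite mulrAC divff ?mul1r.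
Qed.

End Basis.

(** * Finite extensions given by a basis, and their composita *)

Definition is_basis (k L : fieldType) (s : {rmorphism k -> L}) N (e : 'I_N -> L) :=
  independent s e /\ forall g, in_span s e g.

Section ExtensionFromBasis.
Variables (k L : fieldType) (s : {rmorphism k -> L}) (N : nat) (e : 'I_N -> L).
Hypothesis bas : is_basis s e.

(** A copy of L tagged with its basis. All fields in the application are the same C(X) with several
    embeddings, and the tag records through which of them scalars act and what the dimension is. *)
Definition ext_of of is_basis s e : Type := L.
Local Notation V := (ext_of bas).

HB.instance Definition _ := GRing.Field.on V.

Definition ext_scale (a : k) (u : V) : V := (s a : V) * u.

Fact ext_scaleA a b u : ext_scale a (ext_scale b u) = ext_scale (a * b) u.
Proof. by rewrite /ext_scale rmorphM mulrA. Qed.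

Fact ext_scale1 : left_id 1 ext_scale.
Proof. by move=> u; rewrite /ext_scale rmorph1 mul1r. Qed.

Fact ext_scaleDr : right_distributive ext_scale +%R.
Proof. by move=> a u v; exact: mulrDr. Qed.

Fact ext_scaleDl v : {morph ext_scale^~ v : a b / a + b}.
Proof. by move=> a b; rewrite /ext_scale rmorphD; exact: mulrDl. Qed.

HB.instance Definition _ := GRing.Zmodule_isLmodule.Build k V
  ext_scaleA ext_scale1 ext_scaleDr ext_scaleDl.

Lemma ext_scaleE a (u : V) : a *: u = (s a : L) * (u : L) :> L.
Proof. by []. Qed.

Fact ext_scaleAl (a : k) (u v : V) : a *: (u * v) = (a *: u) * v.
Proof. exact: mulrA. Qed.

HB.instance Definition _ := GRing.Lmodule_isLalgebra.Build k V ext_scaleAl.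

Fact ext_scaleAr (a : k) (u v : V) : a *: (u * v) = u * (a *: v).
Proof. exact: mulrCA. Qed.

HB.instance Definition _ := GRing.Lalgebra_isAlgebra.Build k V ext_scaleAr.

Fact ext_vector_axiom : vector_axiom_def N V.
Proof.
pose r2v (v : 'rV[k]_N) : V := \sum_j s (v 0 j) * e j.
have r2v_lin : linear r2v.
  move=> a u v; rewrite /r2v ext_scaleE mulr_sumr -big_split /=.
  by apply: eq_bigr => j _; rewrite !mxE rmorphD rmorphM mulrDl mulrA.
pose r2vM := GRing.isLinear.Build _ _ _ _ r2v r2v_lin.
pose r2vL : {linear _ -> _} := HB.pack r2v r2vM.
have [ind span] := bas.
pose v2r (x : V) : 'rV[k]_N := \row_j sval (cid (span x)) j.
have v2rK : cancel v2r r2vL.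
  move=> x; rewrite {2}(svalP (cid (span x))) /=.
  by apply: eq_bigr => j _; rewrite mxE.
have r2vK : cancel r2v v2r.
  move=> v; apply/rowP => j; apply/eqP; rewrite -subr_eq0; apply/eqP.
  apply: (ind (fun j => v2r (r2v v) 0 j - v 0 j)).
  transitivity (r2v (v2r (r2v v)) - r2v v); last by rewrite [r2v (v2r _)]v2rK subrr.
  rewrite /r2v -sumrB; apply: eq_bigr => l _.
  by rewrite rmorphB mulrBl.
by exists v2r; [apply: can2_linear v2rK|exists r2v].
Qed.

HB.instance Definition _ := Lmodule_hasFinDim.Build k V ext_vector_axiom.

Lemma dim_ext : \dim {:V} = N.
Proof. exact: dimvf. Qed.

Lemma ext_free n (c : 'I_n -> V) : independent s c -> free [tuple c j | j < n].
Proof.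
move=> ind; apply/freeP => x x0; apply: ind; rewrite -[RHS]x0.
by apply: eq_bigr => j _; rewrite -tnth_nth tnth_mktuple.
Qed.

Lemma ext_dim_span n (c : 'I_n -> V) : independent s c ->
  \dim <<[tuple c j | j < n]>> = n.
Proof. by move/ext_free/eqP; rewrite size_tuple. Qed.

Lemma ext_spanP n (c : 'I_n -> V) x :
  reflect (in_span s c x) (x \in <<[tuple c j | j < n]>>%VS).
Proof.
apply: (iffP idP) => [/coord_span xE|[y ->]].
  exists (fun j => coord [tuple c j | j < n] j x); rewrite [LHS]xE.
  by apply: eq_bigr => j _; rewrite -tnth_nth tnth_mktuple.
apply: rpred_sum => j _; rewrite -[_ * _]/(y j *: c j : V).
apply/memvZ/memv_span/mapP; exists j => //; exact: mem_enum.
Qed.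

Lemma ext_is_aspace (K1 : fieldType) (j1 : {rmorphism K1 -> L}) (U : {vspace V}) :
  (forall x : V, x \in U <-> exists a, x = j1 a) -> is_aspace U.
Proof.
move=> H; apply/andP; split.
  by apply: has_algid1; apply/H; exists 1; rewrite rmorph1.
apply/prodvP => u v /H[a ->] /H[b ->]; apply/H; exists (a * b).
by rewrite rmorphM.
Qed.

Lemma ext_free_of_full n (c : 'I_n -> V) : n = N ->
  (forall x, in_span s c x) -> independent s c.
Proof.
move=> nN span; have : free [tuple c j | j < n].
  rewrite /free size_tuple; have -> : <<[tuple c j | j < n]>>%VS = fullv.
    by apply/eqP; rewrite eqEsubv subvf; apply/subvP => x _; apply/ext_spanP.
  by rewrite dim_ext nN.
move/freeP => H x x0; apply: H; rewrite -[RHS]x0.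
by apply: eq_bigr => j _; rewrite -tnth_nth tnth_mktuple.
Qed.

End ExtensionFromBasis.

Section Compositum.
Variables (K0 K1 K2 L : fieldType).
Variables (s1 : {rmorphism K0 -> K1}) (s2 : {rmorphism K0 -> K2}).
Variables (j1 : {rmorphism K1 -> L}) (j2 : {rmorphism K2 -> L}) (s : {rmorphism K0 -> L}).
Hypothesis j1s1 : forall a, j1 (s1 a) = s a.
Hypothesis j2s2 : forall a, j2 (s2 a) = s a.
Variables (N1 N2 N : nat) (e1 : 'I_N1 -> K1) (e2 : 'I_N2 -> K2) (e : 'I_N -> L).
Hypothesis NE : N = (N1 * N2)%N.
Hypothesis bas1 : is_basis s1 e1.
Hypothesis bas2 : is_basis s2 e2.
Hypothesis bas : is_basis s e.
Hypothesis coN : coprime N1 N2.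

Local Notation V := (ext_of bas).

Lemma subfield_of_basis (M : fieldType) (t : {rmorphism K0 -> M})
    (j : {rmorphism M -> L}) n (b : 'I_n -> M) : (forall a, j (t a) = s a) -> is_basis t b ->
  exists U : {subfield V}, \dim U = n /\ forall x : V, x \in U <-> exists a, x = j a.
Proof.
move=> jt [ind span]; pose c l : V := j (b l).
have mem (x : V) : x \in <<[tuple c l | l < n]>>%VS <-> exists a, x = j a.
  split=> [/(elimT (ext_spanP c x))[y ->]|[a ->]].
    exists (\sum_l t (y l) * b l); rewrite rmorph_sum; apply: eq_bigr => l _.
    by rewrite rmorphM jt.
  apply: (introT (ext_spanP c (j a))); have [y ->] := span a; exists y.
  by rewrite rmorph_sum; apply: eq_bigr => l _; rewrite rmorphM jt.
have indc : independent s c.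
  move=> y y0; apply: ind; apply: (fmorph_inj j); rewrite rmorph0 -[RHS]y0 rmorph_sum.
  by apply: eq_bigr => l _; rewrite rmorphM jt.
exists (ASpace (ext_is_aspace mem)); split=> //.
exact: ext_dim_span.
Qed.

(* The product [U1 * U2] is a module over both subfields [U1] and [U2], so its
   dimension is divisible by [N1 * N2 = N]. *)
Lemma compositum_span (y : L) : exists t : seq (K1 * K2), y = \sum_(p <- t) j1 p.1 * j2 p.2.
Proof.
have [U1 [dU1 mU1]] := subfield_of_basis j1s1 bas1.
have [U2 [dU2 mU2]] := subfield_of_basis j2s2 bas2.
have dvd1 : (N1 %| \dim (U1 * U2))%N.
  by rewrite -dU1; apply: field_module_dimS; rewrite prodvA prodv_id.
have dvd2 : (N2 %| \dim (U1 * U2))%N.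
  by rewrite -dU2; apply: field_module_dimS; rewrite prodvCA prodv_id.
have le d : (0 < d)%N -> (N1 %| d)%N -> (N2 %| d)%N -> (N <= d)%N.
  by move=> d0 d1 d2; rewrite NE dvdn_leq // Gauss_dvd // d1.
have full : (U1 * U2)%VS = fullv.
  apply/eqP; rewrite eqEdim subvf dim_ext; apply: le => //.
  rewrite lt0n dimv_eq0 -subv0; apply/negP => /subvP/(_ 1).
  by rewrite -[X in X \in (_ * _)%VS]mulr1 memv_mul ?mem1v // memv0 oner_eq0 => /(_ isT).
have : (y : V) \in (U1 * U2)%VS by rewrite full memvf.
rewrite unlock => /coord_span ->.
elim/big_ind: _ => [|u v [t1 ->] [t2 ->]|l _].
- by exists [::]; rewrite big_nil.
- by exists (t1 ++ t2); rewrite big_cat.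
set w := _`_l; have : w \in [seq x1 * x2 | x1 <- vbasis U1, x2 <- vbasis U2].
  by rewrite mem_nth // size_tuple.
case/allpairsP => -[u v] /= [/vbasis_mem/mU1[a ->] /vbasis_mem/mU2[b ->] ->].
exists [:: (s1 (coord (allpairs_tuple *%R (vbasis U1) (vbasis U2)) l (y : V)) * a, b)].
by rewrite big_seq1 /= rmorphM j1s1 -mulrA.
Qed.

(** The N1 N2 products of basis elements span L over [K0] and are as many as its dimension, hence
    are independent. Expanding coefficients from [K2] along [e2] reduces a relation over [K2] to one
    over [K0]. *)
Lemma compositum_independent : independent j2 (fun p => j1 (e1 p)).
Proof.
have cardE : N = #|{: 'I_N1 * 'I_N2}| by rewrite card_prod !card_ord.
pose P : 'I_N -> 'I_N1 * 'I_N2 :=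
  fun l => enum_val (cast_ord cardE l).
pose c (l : 'I_N) : V := j1 (e1 (P l).1) * j2 (e2 (P l).2).
have Pbij : bijective P.
  apply: bij_comp (enum_val_bij _) _; exists (cast_ord (esym cardE)) => l; exact: val_inj.
have sumE (x : 'I_N1 * 'I_N2 -> K0) :
    \sum_l s (x (P l)) * c l = \sum_p \sum_q s (x (p, q)) * (j1 (e1 p) * j2 (e2 q)).
  rewrite pair_bigA /= (reindex P) /=; last exact: onW_bij.
  by apply: eq_bigr => l _; rewrite /c; case: (P l).
have spanc (y : L) : in_span s c y.
  have [t ->] := compositum_span y; apply: in_span_sum => -[a b] _ /=.
  have [[_ span1] [_ span2]] := (bas1, bas2).
  have [x1 ->] := span1 a; have [x2 ->] := span2 b.
  have [P' PK P'K] := Pbij.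
  exists (fun l => x1 (P l).1 * x2 (P l).2).
  rewrite (sumE (fun pq => x1 pq.1 * x2 pq.2)) !rmorph_sum mulr_suml.
  apply: eq_bigr => p _; rewrite mulr_sumr; apply: eq_bigr => q _ /=.
  by rewrite !rmorphM j1s1 j2s2 mulrACA.
have indc := @ext_free_of_full _ _ _ _ _ bas _ c erefl spanc.
move=> b b0.
have [ind2 span2] := bas2.
have /choice[x xE] p := span2 (b p).
have x0 pq : x pq.1 pq.2 = 0.
  have [P' PK P'K] := Pbij; rewrite -[pq]P'K.
  apply: (indc (fun l => x (P l).1 (P l).2)).
  rewrite (sumE (fun pq => x pq.1 pq.2)) -[RHS]b0; apply: eq_bigr => p _ /=.
  rewrite xE rmorph_sum mulr_suml; apply: eq_bigr => q _.
  by rewrite rmorphM j2s2 -mulrA [j2 _ * _]mulrC.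
move=> p; rewrite xE big1 // => q _.
by rewrite (x0 (p, q)) rmorph0 mul0r.
Qed.

End Compositum.

(** * The tensor product *)

Section TensorMap.
Variables (K0 K1 K2 L : fieldType).
Variables (s1 : {rmorphism K0 -> K1}) (s2 : {rmorphism K0 -> K2}).
Variables (j1 : {rmorphism K1 -> L}) (j2 : {rmorphism K2 -> L}).
Hypothesis j12 : forall a, j1 (s1 a) = j2 (s2 a).
Local Notation T := (tensor s1 s2).

Definition tsum (t : seq (K1 * K2)) : L := \sum_(p <- t) j1 p.1 * j2 p.2.

Lemma tsum_eq t u : tensor_eq s1 s2 t u -> tsum t = tsum u.
Proof.
rewrite /tsum.
elim=> {t u} [//|//|t u v _ -> //|t t' u u' _ e _ e'|t u|b|a a' b|a b b'|a k b].
- by rewrite !big_cat e e'.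
- by rewrite !big_cat /= addrC.
- by rewrite big_seq1 big_nil rmorph0 mul0r.
- by rewrite big_seq1 big_cons big_seq1 /= rmorphD mulrDl.
- by rewrite big_seq1 big_cons big_seq1 /= rmorphD mulrDr.
- by rewrite !big_seq1 /= !rmorphM j12 mulrA.
Qed.

(* The compatibility hypothesis is an argument so that the morphism structure
   below can be found by unification. *)
Definition tensor_map of (forall a, j1 (s1 a) = j2 (s2 a)) :=
  fun x : T => tsum (repr x).
Local Notation tmap := (tensor_map j12).

Lemma tensor_map_cls t : tmap (tcls s1 s2 t) = tsum t.
Proof. by apply: tsum_eq; exact: repr_tcls. Qed.

Lemma tsum_neg t : tsum (tneg t) = - tsum t.
Proof.
by rewrite /tsum big_map -sumrN; apply: eq_bigr => p _; rewrite rmorphN mulNr.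
Qed.

Lemma tsum_mul t u : tsum (tmul t u) = tsum t * tsum u.
Proof.
rewrite /tsum /tmul big_allpairs_dep mulr_suml; apply: eq_bigr => p _.
by rewrite mulr_sumr; apply: eq_bigr => q _; rewrite !rmorphM mulrACA.
Qed.

Fact tensor_map_is_zmod_morphism : zmod_morphism tmap.
Proof.
move=> x y; rewrite -(tcls_repr x) -(tcls_repr y).
have -> : tcls s1 s2 (repr x) - tcls s1 s2 (repr y) =
    tcls s1 s2 (repr x ++ tneg (repr y)).
  by rewrite -tensor_addE -tensor_oppE.
by rewrite !tensor_map_cls /tsum big_cat -/(tsum (tneg _)) tsum_neg.
Qed.
HB.instance Definition _ := GRing.isZmodMorphism.Build T L tmap
  tensor_map_is_zmod_morphism.

Fact tensor_map_is_monoid_morphism : monoid_morphism tmap.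
Proof.
split=> [|x y].
  by rewrite [LHS]tensor_map_cls /tsum big_seq1 /= !rmorph1 mul1r.
rewrite -(tcls_repr x) -(tcls_repr y).
have -> : tcls s1 s2 (repr x) * tcls s1 s2 (repr y) = tcls s1 s2 (tmul (repr x) (repr y)).
  by rewrite -tensor_mulE.
by rewrite !tensor_map_cls tsum_mul.
Qed.
HB.instance Definition _ := GRing.isMonoidMorphism.Build T L tmap
  tensor_map_is_monoid_morphism.

Lemma tensor_map_pure a b : tmap (pure_tensor s1 s2 a b) = j1 a * j2 b.
Proof. by rewrite tensor_map_cls /tsum big_seq1. Qed.

Local Notation pure := (pure_tensor s1 s2).

Lemma tcls_cat t u : tcls s1 s2 (t ++ u) = tcls s1 s2 t + tcls s1 s2 u.
Proof. by rewrite -tensor_addE. Qed.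

Lemma pureDl a a' b : pure (a + a') b = pure a b + pure a' b.
Proof. by rewrite -[RHS]tcls_cat; apply/tclsP; exact: teq_Dl. Qed.

Lemma pureDr a b b' : pure a (b + b') = pure a b + pure a b'.
Proof. by rewrite -[RHS]tcls_cat; apply/tclsP; exact: teq_Dr. Qed.

Lemma pure0l b : pure 0 b = 0.
Proof. by apply/tclsP; exact: teq_0. Qed.

Lemma pure0r a : pure a 0 = 0.
Proof. by apply: (addrI (pure a 0)); rewrite addr0 -pureDr addr0. Qed.

Lemma pure_bal a c b : pure (a * s1 c) b = pure a (s2 c * b).
Proof. by apply/tclsP; exact: teq_bal. Qed.

(** Only existence is claimed; that the b_l are determined is seen after mapping to L, in
    [tensor_map_inj]. *)
Lemma tensor_expand N (e1 : 'I_N -> K1) (x : T) :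
  (forall g, in_span s1 e1 g) -> exists b : 'I_N -> K2, x = \sum_l pure (e1 l) (b l).
Proof.
move=> span; rewrite -(tcls_repr x); elim: (repr x) => [|[a b] t [c cE]].
  by exists (fun=> 0); rewrite big1 // => l _; exact: pure0r.
have [y aE] := span a; exists (fun l => s2 (y l) * b + c l).
rewrite -cat1s tcls_cat cE.
under [RHS]eq_bigr => l _ do rewrite pureDr -pure_bal mulrC.
rewrite big_split; congr (_ + _); rewrite -[LHS]/(pure a b) aE.
by elim/big_rec2: _ => [|l u v _ <-]; [exact: pure0l|rewrite pureDl].
Qed.

Lemma tensor_map_inj N (e1 : 'I_N -> K1) : (forall g, in_span s1 e1 g) ->
  independent j2 (fun l => j1 (e1 l)) -> injective tmap.
Proof.
move=> span ind x y /eqP; rewrite -subr_eq0 -raddfB.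
have [b bE] := tensor_expand (x - y) span.
rewrite bE raddf_sum /= => /eqP sum0.
apply/eqP; rewrite -subr_eq0 bE big1 // => l _; rewrite (ind b) ?pure0r // -[RHS]sum0.
by apply: eq_bigr => i _; rewrite tensor_map_pure mulrC.
Qed.

Lemma tensor_map_surj : (forall y, exists t, y = tsum t) ->
  forall y, exists x, tmap x = y.
Proof. by move=> H y; have [t ->] := H y; exists (tcls s1 s2 t); rewrite tensor_map_cls. Qed.

End TensorMap.

(** * The extensions given by Lattes maps *)

Lemma inj_surj_bij (T U : Type) (f : T -> U) :
  injective f -> (forall y, exists x, f x = y) -> bijective f.
Proof.
by move=> finj /choice[g gK]; exists g => // x; apply: finj; rewrite gK.
Qed.

Section Lattes.
Variable C : numClosedFieldType.
Variable E : elliptic_curve C.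
Local Notation K := (ratfun C).

Lemma pullback_basis n (i : {rmorphism K -> K}) : (0 < n)%N ->
  is_pullback (lattes E n) i -> is_basis i (@Xpow C (n ^ 2)).
Proof.
move=> n0 iP; have [A [B [[cAB monA szA szB _] iX]]] := pullback_shape n0 iP.
have iC := pullback_cst iP.
have B0 : B != 0 by rewrite -size_poly_gt0 szB expn_gt0 n0.
have szB' : (size B <= n ^ 2)%N by rewrite szB.
split; first exact: Xpow_independent iC iX cAB monA szA B0.
exact: Xpow_span iC iX cAB monA szA szB' B0.
Qed.

Lemma ramified_lattes n (i : {rmorphism K -> K}) (s : seq C) : (2 < n)%N ->
  is_pullback (lattes E n) i -> (forall x, root (wpoly E) x = (x \in s)) ->
  forall x, ramified_over i x <-> x \in None :: map Some s.
Proof.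
move=> n2 iP sE x; have n0 : (0 < n)%N by case: n n2 {iP}.
have [A [B [sh iX]]] := pullback_shape n0 iP.
split=> [|xS].
  case: x => // z /(ramified_root n0 iP sh iX); rewrite sE => zs.
  by rewrite inE /= map_f.
apply: (root_ramified n0 iP sh iX n2); case: x xS => // z.
by rewrite inE /= mem_map ?sE // => ? ? [].
Qed.

End Lattes.

Theorem proposition4p1 (R : realType) (E : elliptic_curve R[i]) (l m : nat)
    (l_gt2 : (2 < l)%N) (m_gt2 : (2 < m)%N) (co_lm : coprime l m)
    (iL iM iLM : {rmorphism ratfun R[i] -> ratfun R[i]})
    (iLP : is_pullback (lattes E l) iL)
    (iMP : is_pullback (lattes E m) iM)
    (iLMP : is_pullback (lattes E (l * m)) iLM) :
  (exists S : seq (P1 R[i]),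
     [/\ uniq S, size S = 4%N,
         forall x, ramified_over iL x <-> x \in S
       & forall x, ramified_over iM x <-> x \in S]) /\
  (exists f : {rmorphism tensor iL iM -> ratfun R[i]},
     bijective f /\ forall k, f (tensor_in iL iM k) = iLM k).
Proof.
have l0 : (0 < l)%N by apply: leq_trans l_gt2.
have m0 : (0 < m)%N by apply: leq_trans m_gt2.
split.
  have [s [us szs sE]] := wpoly_roots E.
  exists (None :: map Some s); split.
  - rewrite /= map_inj_uniq ?us ?andbT //; last by move=> ? ? [].
    by apply/mapP => -[].
  - by rewrite /= size_map szs.
  - exact: ramified_lattes iLP sE.
  - exact: ramified_lattes iMP sE.
(* The embeddings cross over: L, which is C(X) over K by [iL], enters the top field through [iM],
   and M enters through [iL]. Both composites from K must be [iLM]. *)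
have LM a : iL (iM a) = iLM a := pullback_comp l0 m0 iLP iMP iLMP a.
have ML a : iM (iL a) = iLM a.
  by apply: (pullback_comp m0 l0 iMP iLP); rewrite mulnC.
have comm a : iM (iL a) = iL (iM a) by rewrite ML LM.
have basL := pullback_basis l0 iLP.
have basM := pullback_basis m0 iMP.
have basLM := pullback_basis (etrans (muln_gt0 l m) (introT andP (conj l0 m0))) iLMP.
have NE : ((l * m) ^ 2 = l ^ 2 * m ^ 2)%N by exact: expnMn.
have co2 : coprime (l ^ 2) (m ^ 2) by rewrite coprimeXl ?coprimeXr.
exists (tensor_map comm); split; last first.
  by move=> k; rewrite /= tensor_map_pure rmorph1 mulr1 ML.
apply: inj_surj_bij.
  apply: (@tensor_map_inj _ _ _ _ _ _ _ _ comm _ _ (proj2 basL)).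
  exact: (compositum_independent ML LM NE basL basM basLM co2).
apply: tensor_map_surj.
exact: (compositum_span ML LM NE basL basM basLM co2).
Qed.
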